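(* Let $k$ be an algebraically closed field, $Q$ a finite quiver, and identify $\mathfrak{msa}(Q)$ with the variety of maximal subalgebras of $B=T_2Q=kQ/J(Q)^2$. Then the irreducible components of $\mathfrak{msa}(Q)$ are explicitly the following: (1) for each two-element subset $\{s,t\}\subset Q_0$ such that $sQ_1t\cup tQ_1s=\emptyset$, the singleton $\{A(s+t)\}$ is an irreducible component of dimension $0$; (2) for each $(s,t)\in V^2(Q)$ with $s\neq t$, the collection $$\Big(\bigcup_{U\in\mathbb P((skQ_1t)^* )}\operatorname{Inn}^*(B)\cdot A(s,t,U)\Big)\cup\{A(s+t)\}$$ is an irreducible component of dimension $|sQ_1t|$; (3) for each $(s,s)\in V^2(Q)$, the collection $$\bigcup_{U\in\mathbb P((skQ_1s)^* )}\operatorname{Inn}^*(B)\cdot A(s,s,U)$$ is an irreducible component of dimension $|sQ_1s|-1$. These irreducible components are all projective spaces, and the dimension of $\mathfrak{msa}(Q)$ is the maximum of the following numbers: $0$ for each two-element subset $\{s,t\}\subset Q_0$ with $sQ_1t\cup tQ_1s=\emptyset$, $|sQ_1t|$ for each $(s,t)\in V^2(Q)$ with $s\neq t$, and $|sQ_1s|-1$ for each $(s,s)\in V^2(Q)$. Furthermore, $\mathfrak{msa}(Q)$ is an irreducible projective variety if and only if $Q$ is an $m$-Kronecker quiver, an $m$-loop quiver (for some $m\ge1$), or the two isolated vertices quiver.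
   Context: Algebras are unital, associative, finite-dimensional over $k$; subalgebras contain the unit. $\operatorname{AlgGr}_m(B)$ is the variety of $m$-dimensional subalgebras of $B$, closed in the Grassmannian $\operatorname{Gr}_m(B)$. $\mathfrak{msa}(Q):=\operatorname{AlgGr}_{n-1}(T_2Q)$ with $n=\dim_kT_2Q$; its points are exactly the maximal subalgebras of $T_2Q$. Varieties may be reducible. $Q_0$, $Q_1$ are the vertex and arrow sets; $J(Q)\subset kQ$ is the two-sided ideal generated by the arrows; $uQ_1v$ is the set of arrows with source $u$ and target $v$, $ukQ_1v$ its $k$-span, and $V^2(Q)=\{(u,v)\in Q_0\times Q_0\mid uQ_1v\neq\emptyset\}$. $J(B)$ is the Jacobson radical of $B$. For a two-element subset $\{u,v\}\subset Q_0$, $A(u+v)=k(u+v)\oplus\bigoplus_{w\in Q_0\setminus\{u,v\}}kw\oplus J(B)$. For $(u,v)\in V^2(Q)$ and a codimension-1 subspace $U\le ukQ_1v$, $A(u,v,U)=kQ_0\oplus U\oplus\bigoplus_{(w,y)\in Q_0^2\setminus\{(u,v)\}}wkQ_1y\oplus J(B)^2$ (with $J(B)^2=0$ here). $\mathbb P((ukQ_1v)^* )$ is identified with the set of codimension-1 subspaces of $ukQ_1v$. $\operatorname{Inn}^*(B)=\{\iota_{1+x}\mid x\in J(B)\}$ with $\iota_u(y)=uyu^{-1}$, and $\operatorname{Inn}^*(B)\cdot A$ is the orbit of $A$. The $m$-loop quiver has one vertex and $m$ loops. The $m$-Kronecker quiver has two vertices $s\ne t$ and exactly $m$ arrows, all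 from $s$ to $t$. The two isolated vertices quiver has two vertices and no arrows. *)

(* Defs.v *)
From HB Require Import structures.
From mathcomp Require Import all_boot all_order all_algebra all_field.
From mathcomp Require Import boolp classical_sets topology_structure.
From mathcomp Require Import mpoly.

Set Implicit Arguments.
Unset Strict Implicit.
Unset Printing Implicit Defensive.

Import Order.TTheory GRing.Theory.
Local Open Scope classical_set_scope.
Local Open Scope ring_scope.

Section Topology.
Variable T : topologicalType.
Implicit Types X Z : set T.

Definition irreducible Z := Z !=set0 /\
  forall F G : set T, closed F -> closed G ->
    Z `<=` F `|` G -> Z `<=` F \/ Z `<=` G.

Definition irreducible_component X Z :=
  [/\ Z `<=` X, irreducible Z &
      forall Z', Z' `<=` X -> irreducible Z' -> Z `<=` Z' -> Z' = Z].

Definition closed_in X Z := exists2 F, closed F & Z = X `&` F.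

Definition has_chain X (d : nat) := exists Z : nat -> set T,
  (forall i, (i <= d)%N -> closed_in X (Z i) /\ irreducible (Z i)) /\
  (forall i, (i < d)%N -> Z i `<` Z i.+1).

End Topology.

Definition is_max (N : set nat) (d : nat) :=
  N d /\ forall e, N e -> (e <= d)%N.

(* X has Krull dimension d.  The dimension is kept as a relation because the
   empty space has none (as the empty set of numbers has no maximum). *)
Definition dimension (T : topologicalType) (X : set T) (d : nat) :=
  is_max (has_chain X) d.

(* The set of all subspaces of V, i.e. the disjoint union of the Gr_m(V); it
   carries the Zariski topology, for which each Gr_m(V) is open and closed. *)
Definition grassmannian (k : fieldType) (V : vectType k) : Type := {vspace V}.

Section Grassmannian.
Variables (k : fieldType) (V : vectType k).

HB.instance Definition _ := Choice.copy (grassmannian V) {vspace V}.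

Definition Gr (m : nat) : set (grassmannian V) :=
  [set U : {vspace V} | \dim U = m].

(* Pluecker coordinates are indexed by all sequences of m column indices: those
   with a repetition give 0, and permuting a sequence only changes the sign. *)
Definition plucker_index (m : nat) := {ffun 'I_m -> 'I_(\dim {:V})}.

Definition nplucker (m : nat) := #|plucker_index m|.

Definition plucker (m : nat) (U : {vspace V}) : 'I_(nplucker m) -> k :=
  fun j => \det (\matrix_(i < m, l < m)
                   coord (vbasis {:V}) ((enum_val j : plucker_index m) l)
                         (vbasis U)`_i).

Definition homogeneous n (p : {mpoly k[n]}) := exists d, p \is d.-homog.

Definition zero_locus (m : nat) (S : set {mpoly k[nplucker m]}) :
    set (grassmannian V) :=
  [set U | Gr m U /\ forall p, S p -> p.@[plucker U] = 0].

Definition zariski_closed (Z : set (grassmannian V)) :=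
  forall m, exists S : set {mpoly k[nplucker m]},
    S `<=` @homogeneous _ /\ Z `&` Gr m = zero_locus S.

Definition zariski_open (Z : set (grassmannian V)) := zariski_closed (~` Z).

Lemma zariski_openT : zariski_open setT.
Proof.
rewrite /zariski_open setCT => m; exists [set 1]; split.
  by move=> _ ->; exists 0%N; apply: dhomog1.
rewrite set0I; apply/seteqP; split=> // U [_ /(_ 1 erefl)] /eqP.
by rewrite meval1 oner_eq0.
Qed.

Lemma zariski_openI : setI_closed zariski_open.
Proof.
move=> A B Ao Bo m; have [S [hS eS]] := Ao m; have [S' [hS' eS']] := Bo m.
exists [set p * q | p in S & q in S']; split.
  move=> _ [p /hS[d hp] [q /hS'[e hq] <-]]; exists (d + e)%N; exact: dhomogM.
rewrite setCI setIUl eS eS'; apply/seteqP; split=> U.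
  move=> [[mU U0]|[mU U0]]; split=> // _ [p Sp [q Sq <-]].
    by rewrite mevalM U0 ?mul0r.
  by rewrite mevalM (U0 q) ?mulr0.
move=> [mU U0]; have [|/existsNP[p /not_implyP[Sp /eqP p0]]] :=
  pselect (forall p, S p -> p.@[plucker U] = 0); first by left.
right; split=> // q Sq; have /eqP := U0 (p * q) (ex_intro2 _ _ p Sp
  (ex_intro2 _ _ q Sq erefl)).
by rewrite mevalM mulf_eq0 (negPf p0) => /eqP.
Qed.

Lemma zariski_open_bigU (I : Type) (f : I -> set (grassmannian V)) :
  (forall i, zariski_open (f i)) -> zariski_open (\bigcup_i f i).
Proof.
move=> fo m; have [S hS] := choice (fun i => fo i m).
exists (\bigcup_i S i); split; first by move=> p [i _ Sp]; apply: (proj1 (hS i)).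
rewrite setC_bigcup; apply/seteqP; split=> U.
  move=> [Uf mU]; split=> // p [i _ Sp]; have [_ /seteqP[/(_ U) H _]] := hS i.
  by have [|_ ->] := H; first by split=> //; apply: Uf.
move=> [mU U0]; split=> // i _; have [_ /seteqP[_ /(_ U)]] := hS i.
by case=> //; split=> // p Sp; apply: U0; exists i.
Qed.

HB.instance Definition _ := isOpenTopological.Build (grassmannian V)
  zariski_openT zariski_openI zariski_open_bigU.

Lemma zariski_closedE (Z : set (grassmannian V)) :
  closed Z <-> zariski_closed Z.
Proof. by rewrite -openC -{2}(setCK Z). Qed.

End Grassmannian.

Section Morphisms.
Variables (k : fieldType) (V W : vectType k) (m m' : nat).

(* f is a morphism from X, inside Gr_m(V), to Gr_m'(W): around each point it is
   given in homogeneous coordinates by forms of the same degree. *)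
Definition regular_map (X : set (grassmannian V))
    (f : grassmannian V -> grassmannian W) :=
  forall x, X x -> exists N : set (grassmannian V), [/\ open N, N x &
    exists d (F : 'I_(nplucker W m') -> {mpoly k[nplucker V m]}),
      (forall j, F j \is d.-homog) /\
      forall y, X y -> N y -> exists2 c : k, c != 0 &
        forall j, (F j).@[plucker y] = c * plucker (f y) j].

End Morphisms.

Definition isomorphic (k : fieldType) (V W : vectType k) (m m' : nat)
    (X : set (grassmannian V)) (Y : set (grassmannian W)) :=
  X `<=` Gr m /\ Y `<=` Gr m' /\
  exists (f : grassmannian V -> grassmannian W)
         (g : grassmannian W -> grassmannian V),
    [/\ regular_map m m' X f, regular_map m' m Y g,
        forall x, X x -> Y (f x) /\ g (f x) = x &
        forall y, Y y -> X (g y) /\ f (g y) = y].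

(* The projective space P^d is Gr_1(k^(d+1)). *)
Definition is_projective_space (k : fieldType) (V : vectType k) (m : nat)
    (X : set (grassmannian V)) :=
  exists d, isomorphic m 1 X (@Gr k 'rV[k]_d.+1 1).

Definition irreducible_projective_variety (k : fieldType) (V : vectType k)
    (X : set (grassmannian V)) := closed X /\ irreducible X.

(* The intersection is a subspace (memv_bigcap), so the default is never used. *)
Definition bigcapv (k : fieldType) (V : vectType k) (S : set {vspace V}) :
    {vspace V} :=
  xget fullv [set W : {vspace V} | forall x, x \in W <-> forall U, S U -> x \in U].

Lemma memv_bigcap (k : fieldType) (V : vectType k) (S : set {vspace V}) x :
  x \in bigcapv S <-> forall U, S U -> x \in U.
Proof.
rewrite /bigcapv; case: xgetP => [W _ /(_ x)//|H].
have [n leVn] := ubnP (\dim {:V}).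
suff: forall W : {vspace V}, (\dim W < n)%N ->
    (forall x, (forall U, S U -> x \in U) -> x \in W) ->
    exists W' : {vspace V}, forall x, x \in W' <-> forall U, S U -> x \in U.
  by case/(_ fullv leVn) => [y _|W' hW']; [rewrite memvf | case: (H W')].
elim: n {leVn H} => // n IHn W leWn WS.
have [WU|/existsNP[U /not_implyP[SU /negP nWU]]] :=
  pselect (forall U, S U -> (W <= U)%VS).
  by exists W => y; split=> [Wy U SU|/WS//]; apply: (subvP (WU U SU)).
apply: (IHn (W :&: U)%VS); last by move=> y Sy; rewrite memv_cap WS// Sy.
rewrite -ltnS; apply: leq_trans leWn; rewrite ltnS.
by rewrite (ltn_leqif (dimv_leqif_sup (capvSl W U))) subv_cap subvv.
Qed.

Section Algebras.
Variables (k : fieldType) (B : falgType k).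

Definition subalgebra (A : {vspace B}) := 1 \in A /\ (A * A <= A)%VS.

Definition AlgGr (m : nat) : set (grassmannian B) :=
  [set A | Gr m A /\ subalgebra A].

Definition left_ideal (I : {vspace B}) := (fullv * I <= I)%VS.

Definition maximal_left_ideal (I : {vspace B}) :=
  [/\ left_ideal I, I != fullv & forall I' : {vspace B},
     left_ideal I' -> (I <= I')%VS -> I' = I \/ I' = fullv].

Definition jacobson : {vspace B} := bigcapv maximal_left_ideal.

Definition iota_ (u : B) : 'End(B) := linfun (fun y : B => u * y * u^-1).

Definition Inn_orbit (A : {vspace B}) : set (grassmannian B) :=
  [set C | exists2 x, x \in jacobson & C = (iota_ (1 + x) @: A)%VS].

End Algebras.

Record quiver := Quiver {
  vertex : finType;
  arrow : finType;
  src : arrow -> vertex;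
  tgt : arrow -> vertex;
  vertex_gt0 : (0 < #|vertex|)%N
}.

Definition arrows (Q : quiver) (u v : vertex Q) : {set arrow Q} :=
  [set a | (src a == u) && (tgt a == v)].

Definition V2 (Q : quiver) : {set vertex Q * vertex Q} :=
  [set p | arrows p.1 p.2 != finset.set0].

(* kQ / J(Q)^2: its basis is given by the classes of the paths of length at most
   one, that is, the vertices (inl) and the arrows (inr). *)
Definition T2 (k : fieldType) (Q : quiver) : Type :=
  {ffun vertex Q + arrow Q -> k^o}.

Section T2.
Variables (k : fieldType) (Q : quiver).
Local Notation B := (T2 k Q).

HB.instance Definition _ := Vector.copy B {ffun vertex Q + arrow Q -> k^o}.

Definition e_ (v : vertex Q) : B := [ffun i => (i == inl v)%:R].
Definition a_ (a : arrow Q) : B := [ffun i => (i == inr a)%:R].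

(* Paths compose from left to right, so the only nonzero products of basis
   elements are e_v e_v = e_v and e_(src a) a = a = a e_(tgt a). *)
Definition T2_mul (x y : B) : B := [ffun i => match i with
  | inl v => x (inl v) * y (inl v)
  | inr a => x (inl (src a)) * y (inr a) + x (inr a) * y (inl (tgt a))
  end].

Definition T2_one : B := \sum_v e_ v.

Lemma T2_oneE i : T2_one i = if i is inl _ then 1 else 0.
Proof.
rewrite /T2_one sum_ffunE; case: i => [v|a].
  rewrite (bigD1 v)//= big1 ?ffunE ?eqxx ?addr0// => w /negPf wv.
  by rewrite ffunE -[inl v == _]/(v == w) eq_sym wv.
by rewrite big1// => w _; rewrite ffunE.
Qed.

Lemma T2_mulA : associative T2_mul.
Proof.
move=> x y z; apply/ffunP => -[v|a]; rewrite !ffunE ?mulrA//.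
by rewrite mulrDl mulrDr !mulrA addrA.
Qed.

Lemma T2_mul1 : left_id T2_one T2_mul.
Proof.
by move=> x; apply/ffunP => -[v|a]; rewrite !ffunE !T2_oneE ?mul0r ?addr0 mul1r.
Qed.

Lemma T2_mulr1 : right_id T2_one T2_mul.
Proof.
by move=> x; apply/ffunP => -[v|a]; rewrite !ffunE !T2_oneE ?mulr0 ?add0r mulr1.
Qed.

Lemma T2_mulDl : left_distributive T2_mul +%R.
Proof.
move=> x y z; apply/ffunP => -[v|a]; rewrite !ffunE !mulrDl//.
exact: addrACA.
Qed.

Lemma T2_mulDr : right_distributive T2_mul +%R.
Proof.
move=> x y z; apply/ffunP => -[v|a]; rewrite !ffunE !mulrDr//.
exact: addrACA.
Qed.

Lemma T2_one_neq0 : T2_one != 0.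
Proof.
apply/eqP => /ffunP/=; have /card_gt0P[v _] := vertex_gt0 Q.
by move=> /(_ (inl v))/eqP; rewrite T2_oneE ffunE oner_eq0.
Qed.

HB.instance Definition _ := GRing.Zmodule_isNzRing.Build B
  T2_mulA T2_mul1 T2_mulr1 T2_mulDl T2_mulDr T2_one_neq0.

Lemma T2_scaleAl (c : k) (x y : B) : c *: (x * y) = (c *: x) * y.
Proof.
by apply/ffunP => -[v|a]; rewrite !ffunE /GRing.scale/= ?mulrDr !mulrA.
Qed.

HB.instance Definition _ := GRing.Lmodule_isLalgebra.Build k B T2_scaleAl.

Lemma T2_scaleAr (c : k) (x y : B) : c *: (x * y) = x * (c *: y).
Proof.
apply/ffunP => -[v|a]; rewrite !ffunE /GRing.scale/= ?mulrDr !mulrA.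
  by rewrite (mulrC c).
by rewrite !(mulrC c).
Qed.

HB.instance Definition _ := GRing.Lalgebra_isAlgebra.Build k B T2_scaleAr.
HB.instance Definition _ := Algebra_isFalgebra.Build k B.

End T2.

Lemma T2_decomp (k : fieldType) (Q : quiver) (x : T2 k Q) :
  x = \sum_v x (inl v) *: e_ k v + \sum_b x (inr b) *: a_ k b.
Proof.
apply/ffunP => i; rewrite ffunE !sum_ffunE.
case: i => [v|b]; [rewrite [X in _ + X]big1 ?addr0 => [|b _] |
  rewrite [X in X + _]big1 ?add0r => [|v _]]; rewrite ?ffunE ?scaler0//.
- rewrite (bigD1 v)//= big1 ?addr0 => [|w wv]; rewrite !ffunE.
    by rewrite eqxx /GRing.scale/= mulr1.
  by rewrite -[inl v == _]/(v == w) eq_sym (negPf wv) scaler0.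
- rewrite (bigD1 b)//= big1 ?addr0 => [|c cb]; rewrite !ffunE.
    by rewrite eqxx /GRing.scale/= mulr1.
  by rewrite -[inr b == _]/(b == c) eq_sym (negPf cb) scaler0.
Qed.

(* The relations satisfied by the images of the vertices and of the arrows under
   an algebra morphism from kQ to C which kills J(Q)^2. *)
Definition T2_relations (k : fieldType) (Q : quiver) (C : algType k)
    (e : vertex Q -> C) (a : arrow Q -> C) :=
  [/\ forall u v, e u * e v = if u == v then e u else 0,
      \sum_v e v = 1,
      forall b, e (src b) * a b * e (tgt b) = a b &
      forall b c, a b * a c = 0].

Lemma T2_generatorsP (k : fieldType) (Q : quiver) :
  T2_relations (@e_ k Q) (@a_ k Q).
Proof.
split=> [u v||b|b c]; last first.
- by apply/ffunP => -[w|d]; rewrite !ffunE/= ?mul0r ?mulr0 ?addr0.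
- apply/ffunP => -[w|d]; rewrite !ffunE/=; first by rewrite mulr0 mul0r.
  rewrite -![inr d == _]/(d == b) -![inl _ == _]/(_ == _).
  case: (eqVneq d b) => [->|_]; rewrite ?eqxx ?mul0r ?mulr0 ?mul0r ?addr0 ?mulr1 ?add0r//.
  by rewrite mul0r.
- by [].
apply/ffunP => -[w|d]; last first.
  by rewrite !ffunE/= !(mul0r, mulr0) addr0; case: ifP; rewrite ffunE.
rewrite !ffunE -![inl w == _]/(w == _).
case: (eqVneq u v) => [<-|uv]; rewrite ffunE -?[inl w == _]/(w == _).
  by case: (w == u); rewrite ?mul1r ?mul0r.
by have [wu|] := boolP (w == u); rewrite ?mul0r// (eqP wu) (negPf uv) mulr0.
Qed.

(* The universal property of kQ / J(Q)^2. *)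
Lemma T2_universal (k : fieldType) (Q : quiver) (C : algType k)
    (e : vertex Q -> C) (a : arrow Q -> C) :
  T2_relations e a ->
  exists f : {lrmorphism T2 k Q -> C},
    [/\ forall v, f (e_ k v) = e v, forall b, f (a_ k b) = a b &
      forall g : {lrmorphism T2 k Q -> C}, (forall v, g (e_ k v) = e v) ->
        (forall b, g (a_ k b) = a b) -> g =1 f].
Proof.
move=> [ee e1 eae aa].
have ea u b : e u * a b = if u == src b then a b else 0.
  by rewrite -{1}(eae b) !mulrA ee; case: eqP => [->|]; rewrite ?mul0r// eae.
have ae u b : a b * e u = if tgt b == u then a b else 0.
  by rewrite -{1}(eae b) -!mulrA ee; case: eqP => _; rewrite ?mulr0// mulrA eae.
pose f (x : T2 k Q) : C := \sum_v x (inl v) *: e v + \sum_b x (inr b) *: a b.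
have fZ : linear f.
  move=> c x y; rewrite /f scalerDr !scaler_sumr addrACA -!big_split/=.
  by congr (_ + _); apply: eq_bigr => i _; rewrite !ffunE scalerDl scalerA.
have f1 : f 1 = 1.
  rewrite /f [X in _ + X]big1 ?addr0 => [|b _]; last by rewrite T2_oneE scale0r.
  by rewrite -e1; apply: eq_bigr => v _; rewrite T2_oneE scale1r.
have fM : {morph f : x y / x * y}.
  move=> x y; rewrite /f mulrDl !mulrDr.
  have dl (I : finType) (g : I -> C) (l : I -> k) (z : C) :
    (\sum_i l i *: g i) * z = \sum_i l i *: (g i * z).
    by rewrite mulr_suml; apply: eq_bigr => i _; rewrite scalerAl.
  have dr (I : finType) (g : I -> C) (l : I -> k) (z : C) :
    z * (\sum_i l i *: g i) = \sum_i l i *: (z * g i).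
    by rewrite mulr_sumr; apply: eq_bigr => i _; rewrite scalerAr.
  have -> : (\sum_b x (inr b) *: a b) * (\sum_b y (inr b) *: a b) = 0.
    rewrite dl big1// => b _; rewrite dr big1 ?scaler0// => c _.
    by rewrite aa scaler0.
  rewrite addr0 -addrA; congr (_ + _).
    rewrite dl; apply: eq_bigr => v _; rewrite dr (bigD1 v)//= big1 => [|w wv].
      by rewrite ee eqxx addr0 scalerA !ffunE.
    by rewrite ee eq_sym (negPf wv) scaler0.
  rewrite dr dl -big_split/=; apply: eq_bigr => b _.
  rewrite dl (bigD1 (src b))//= big1 => [|w wb]; last first.
    by rewrite ea (negPf wb) scaler0.
  rewrite dr (bigD1 (tgt b))//= big1 => [|w wb]; last first.
    by rewrite ae eq_sym (negPf wb) scaler0.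
  by rewrite ea ae !eqxx !addr0 !ffunE scalerDl !scalerA [y _ * _]mulrC.
pose f1M := GRing.isMonoidMorphism.Build _ _ f (f1, fM).
pose fL := GRing.isLinear.Build _ _ _ _ f fZ.
pose F : {lrmorphism T2 k Q -> C} := HB.pack f f1M fL.
exists F; split=> [v|b|g ge ga x].
- rewrite -[F _]/(f _) /f [X in _ + X]big1 => [|b _]; last by rewrite ffunE scale0r.
  rewrite addr0 (bigD1 v)//= big1 => [|w wv]; first by rewrite ffunE eqxx scale1r addr0.
  by rewrite ffunE -[inl w == _]/(w == v) (negPf wv) scale0r.
- rewrite -[F _]/(f _) /f big1 => [|v _]; last by rewrite ffunE scale0r.
  rewrite add0r (bigD1 b)//= big1 => [|c cb]; first by rewrite ffunE eqxx scale1r addr0.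
  by rewrite ffunE -[inr c == _]/(c == b) (negPf cb) scale0r.
have gZ c y : g (c *: y) = c *: g y by apply: linearZ.
rewrite [in LHS](T2_decomp x) raddfD !raddf_sum -[F _]/(f _) /f.
by congr (_ + _); apply: eq_bigr => i _; rewrite [LHS]gZ ?ge ?ga.
Qed.

Section MaximalSubalgebras.
Variables (k : fieldType) (Q : quiver).
Local Notation B := (T2 k Q).
Local Notation J := (jacobson B).

Definition msa : set (grassmannian B) := @AlgGr k B (\dim {:B} - 1).

(* u kQ_1 v *)
Definition arrow_span (u v : vertex Q) : {vspace B} :=
  (\sum_(b in arrows u v) <[a_ k b]>)%VS.

(* Identified with the projective space P(W^* ). *)
Definition hyperplane (W : {vspace B}) : set {vspace B} :=
  [set U | (U <= W)%VS /\ (\dim U).+1 = \dim W].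

Definition A_sum (u v : vertex Q) : {vspace B} :=
  (<[e_ k u + e_ k v]> + (\sum_(w | (w != u) && (w != v)) <[e_ k w]>) + J)%VS.

Definition A_hyp (u v : vertex Q) (U : {vspace B}) : {vspace B} :=
  ((\sum_w <[e_ k w]>) + U +
   (\sum_(p : vertex Q * vertex Q | p != (u, v)) arrow_span p.1 p.2) +
   J * J)%VS.

Definition hyp_orbits (u v : vertex Q) : set (grassmannian B) :=
  \bigcup_(U in hyperplane (arrow_span u v)) Inn_orbit (A_hyp u v U).

End MaximalSubalgebras.

Arguments msa k Q : clear implicits.
Arguments A_sum k {Q} u v.
Arguments hyp_orbits k {Q} u v.

Definition component_dimensions (Q : quiver) : set nat :=
  [set d | (exists s t : vertex Q, [/\ s != t,
              arrows s t :|: arrows t s = finset.set0 & d = 0%N]) \/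
           (exists s t : vertex Q, [/\ (s, t) \in V2 Q, s != t &
              d = #|arrows s t|]) \/
           (exists s : vertex Q, (s, s) \in V2 Q /\ d = (#|arrows s s| - 1)%N)].

Definition kronecker_quiver (m : nat) (Q : quiver) :=
  exists s t : vertex Q, [/\ s != t, forall v, v = s \/ v = t,
    forall b : arrow Q, src b = s /\ tgt b = t & #|arrow Q| = m].

Definition loop_quiver (m : nat) (Q : quiver) :=
  #|vertex Q| = 1%N /\ #|arrow Q| = m.

Definition two_isolated_vertices (Q : quiver) :=
  #|vertex Q| = 2%N /\ #|arrow Q| = 0%N.

(* Main.v *)
(* A hyperplane of T_2 Q is the kernel of a functional f, and it is a subalgebra
   exactly when f lies in one of the spaces W_st spanned by x_s - x_t and by the
   coordinates x_a of the arrows a from s to t: then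
   f(xy) = x_s f(y) + f(x) y_t, and conversely the vanishing of f(xy) on all x, y
   in the kernel leaves no other f.  So msa(Q) is the union of the linear
   subspaces P(W_st) of the dual projective space.  Conjugating by 1 + x, with x
   in the radical, adds f(x)(x_s - x_t) to a nonzero combination f of the x_a, which
   identifies P(W_st) with the sets of the theorem.

   The Pluecker coordinates of a hyperplane are, up to signs, the coordinates of
   its functional, so P(W_st) is a projective space for the Zariski topology of
   the Grassmannian.  Its Krull dimension is bounded by counting: a chain of r + 1
   irreducible closed sets that meet an affine chart A^n provides polynomials
   f_1, ..., f_r (f_i vanishes on one set but not on the next) whose M^r monomials
   with exponents < M are linearly independent; as their degree is O(M), there are
   at most O(M^n) of them, whence r <= n. *)
From HB Require Import structures.
Require Import Defs.
From mathcomp Require Import all_boot all_order all_algebra all_field.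
From mathcomp Require Import boolp classical_sets topology_structure.
From mathcomp Require Import mpoly zify ring.

Set Implicit Arguments.
Unset Strict Implicit.
Unset Printing Implicit Defensive.

Import Order.TTheory GRing.Theory.
Local Open Scope classical_set_scope.
Local Open Scope ring_scope.

(** * Krull dimension of the affine space *)

Section AffineDimension.
Variables (k : fieldType) (n : nat).
Local Notation poly := {mpoly k[n]}.
Implicit Types (p q f : poly) (Y : set ('I_n -> k)).

Definition vanishes Y p := forall u, Y u -> p.@[u] = 0.

(** For nonempty [Y] this says that the vanishing ideal of [Y] is prime, that is, that the Zariski
    closure of [Y] is irreducible. *)
Definition prime_set Y := forall p q, vanishes Y (p * q) -> vanishes Y p \/
  vanishes Y q.

(** Linear independence of the restrictions to [Y], as functions on [Y]. *)
Definition indep_on Y (I : finType) (F : I -> poly) :=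
  forall c : I -> k, vanishes Y (\sum_i c i *: F i) -> forall i, c i = 0.

Lemma leq_msizeM p q : (msize (p * q) <= (msize p + msize q).-1)%N.
Proof.
have [->|p0] := eqVneq p 0; first by rewrite mul0r msize0.
have [->|q0] := eqVneq q 0; first by rewrite mulr0 msize0.
by rewrite msizeM.
Qed.

(** Let a sum of [g_j * f ^+ j] vanish on [Y']. On [Y], where [f] vanishes, only [g_0] survives, so
    its coefficients are zero. The rest is divisible by [f], which can be cancelled on the prime set
    [Y'], and the argument repeats. *)
Lemma indep_on_mul Y Y' (I : finType) (F : I -> poly) f M :
  Y `<=` Y' -> prime_set Y' -> vanishes Y f -> ~ vanishes Y' f ->
  indep_on Y F ->
  indep_on Y' (fun x : I * 'I_M => F x.1 * f ^+ x.2).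
Proof.
move=> YY' prY' fY fY' indF.
(* The coefficients are indexed by all natural exponents so that the induction on [M] can shift
   them. *)
suff H : forall c : nat -> I -> k,
    vanishes Y' (\sum_(j < M) (\sum_i c j i *: F i) * f ^+ j) ->
    forall (j : 'I_M) i, c j i = 0.
  move=> c c0 [i j].
  pose c' (l : nat) i := if insub l is Some l' then c (i, l' : 'I_M) else 0.
  have c'E (l : 'I_M) i' : c' l i' = c (i', l) by rewrite /c' valK.
  rewrite -c'E; apply: H => u Yu; rewrite -[RHS](c0 u Yu); congr (_.@[_]).
  transitivity (\sum_i \sum_j c (i, j) *: (F i * f ^+ j)); last first.
    by rewrite pair_bigA; apply: eq_bigr => -[].
  rewrite exchange_big/=.
  apply: eq_bigr => l _; rewrite mulr_suml; apply: eq_bigr => i' _.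
  by rewrite c'E scalerAl.
elim: M => [c _ []//|M IHM] c c0.
have c00 : forall i, c 0%N i = 0.
  apply: indF => u Yu; have := c0 u (YY' _ Yu).
  rewrite big_ord_recl/= mulr1 mevalD [X in _ + X]raddf_sum/= [X in _ + X]big1.
    by rewrite addr0.
  by move=> j _; rewrite mevalM /bump/= exprS mevalM fY// mul0r mulr0.
case=> [[|j] ltj] i; first exact: c00.
apply: (IHM (fun j => c j.+1) _ (Ordinal (ltj : (j < M)%N))).
have : vanishes Y' (f * \sum_(j < M) (\sum_i c j.+1 i *: F i) * f ^+ j).
  move=> u Yu; rewrite -[RHS](c0 u Yu) [in RHS]big_ord_recl/= [\sum_i c 0%N i *:
    _]big1.
    rewrite mul0r add0r mulr_sumr; congr (_.@[_]); apply: eq_bigr => l _.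
    by rewrite /bump/= exprS mulrCA.
  by move=> i' _; rewrite c00 scale0r.
by case/prY'.
Qed.

(** A polynomial with [msize] at most [D] has all its exponents below [D], hence lies in a space of
    dimension [D ^ n]. With more polynomials than that, the matrix of coefficients has a nonzero
    left kernel, which is a linear relation. *)
Lemma indep_on_card Y (I : finType) (F : I -> poly) D :
  indep_on Y F -> (forall i, (msize (F i) <= D)%N) -> (#|I| <= D ^ n)%N.
Proof.
move=> indF sF; rewrite leqNgt; apply/negP => ltDI.
pose A := \matrix_(i < #|I|, j < #|{ffun 'I_n -> 'I_D}|)
  (F (enum_val i))@_[multinom nat_of_ord (enum_val j l) | l < n].
have cJ : #|{ffun 'I_n -> 'I_D}| = (D ^ n)%N by rewrite card_ffun !card_ord.
have : ~~ row_free A.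
  by rewrite /row_free neq_ltn (leq_ltn_trans (rank_leq_col _))// cJ.
rewrite -kermx_eq0 => /rowV0Pn[v /sub_kermxP vA v0].
case/negP: v0; apply/eqP/rowP => i; rewrite [RHS]mxE.
have := indF (fun i => v 0 (enum_rank i)) _ (enum_val i); rewrite enum_valK; apply.
suff -> : \sum_i v 0 (enum_rank i) *: F i = 0 by move=> u _; rewrite meval0.
apply/mpolyP => m; rewrite mcoeff0 raddf_sum/=.
have [ltm|lem] := boolP [forall l, (m l < D)%N].
  have {}ltm l : (m l < D)%N by move/forallP: ltm.
  have /matrixP/(_ 0 (enum_rank [ffun l => Ordinal (ltm l)])) := vA.
  rewrite !mxE; apply: etrans;
    rewrite [LHS](reindex _ (onW_bij _ (enum_val_bij I)))/=.
  apply: eq_bigr => j _; rewrite !mxE enum_valK mcoeffZ enum_rankK;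
    congr (_ * _@__).
  by apply/mnmP => l; rewrite mnmE ffunE.
move: lem; rewrite negb_forall => /existsP[l]; rewrite -leqNgt => lem.
rewrite big1// => i' _; rewrite mcoeffZ memN_msupp_eq0 ?mulr0//.
apply: msize_mdeg_ge; apply: leq_trans (sF i') (leq_trans lem _).
by rewrite mdegE (bigD1 l)//= leq_addr.
Qed.

(** The family at stage [i] consists of the monomials in the first [i] polynomials [f] with
    exponents below [M]. It starts from the constant 1, independent on the nonempty [Y 0]. *)
Lemma indep_chain r (Y : nat -> set ('I_n -> k)) (f : nat -> poly) E M :
  Y 0%N !=set0 -> (forall i, (i <= r)%N -> prime_set (Y i)) ->
  (forall i, (i < r)%N -> [/\ Y i `<=` Y i.+1, vanishes (Y i) (f i) &
     ~ vanishes (Y i.+1) (f i)]) ->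
  (forall i, (i < r)%N -> (msize (f i) <= E.+1)%N) ->
  forall i, (i <= r)%N -> exists (I : finType) (F : I -> poly),
    [/\ #|I| = (M ^ i)%N, forall x, (msize (F x) <= (E * M * i).+1)%N &
        indep_on (Y i) F].
Proof.
move=> [u0 Yu0] prY hf sf; elim=> [_|i IHi lti].
  exists 'I_1, (fun=> 1); split; first by rewrite card_ord.
    by move=> _; rewrite msize1.
  move=> c /(_ _ Yu0); rewrite big_ord1 mevalZ meval1 mulr1 => c0 j.
  by rewrite (ord1 j).
have [I [F [cI sF indF]]] := IHi (ltnW lti).
have [YY fY fY'] := hf i lti.
exists (I * 'I_M)%type, (fun x : I * 'I_M => F x.1 * f i ^+ x.2); split.
- by rewrite card_prod card_ord cI expnSr.
- case=> x j /=; have sfj : (msize (f i ^+ j) <= (E * j).+1)%N.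
    elim: (nat_of_ord j) => [|l IHl]; first by rewrite expr0 msize1 muln0.
    rewrite exprS; apply: leq_trans (leq_msizeM _ _) _.
    by move: (sf i lti) IHl; rewrite mulnS; move: (msize _) (msize _) => a b; lia.
  apply: leq_trans (leq_msizeM _ _) _.
  have lej : (E * j <= E * M)%N by rewrite leq_mul2l (ltnW (ltn_ord j)) orbT.
  by move: (sF x) sfj lej; rewrite mulnS; move: (msize _) (msize _) => a b; lia.
- exact: indep_on_mul (prY _ lti) fY fY' indF.
Qed.

Lemma affine_chain_le r (Y : nat -> set ('I_n -> k)) (f : nat -> poly) :
  Y 0%N !=set0 -> (forall i, (i <= r)%N -> prime_set (Y i)) ->
  (forall i, (i < r)%N -> [/\ Y i `<=` Y i.+1, vanishes (Y i) (f i) &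
     ~ vanishes (Y i.+1) (f i)]) ->
  (r <= n)%N.
Proof.
move=> Y0 prY hf; rewrite leqNgt; apply/negP => ltnr.
pose E := (\sum_(i < r) msize (f i))%N.
have sf i : (i < r)%N -> (msize (f i) <= E.+1)%N.
  by move=> lti; rewrite /E (bigD1 (Ordinal lti))//= leqW// leq_addr.
(* [C] is chosen so that [(E * M * r).+1 <= C * M]. As [M] exceeds [C ^ n], the number [M ^ n.+1] is
   larger than [(C * M) ^ n], against the count of monomials. *)
pose C := (E * r).+1; pose M := (C ^ n).+1.
have [I [F [cI sF indF]]] := indep_chain M Y0 prY hf sf (leqnn r).
have := indep_on_card indF sF; rewrite cI => leM.
have : (M ^ n.+1 <= (C * M) ^ n)%N.
  apply: leq_trans (leq_trans leM _); first by rewrite leq_pexp2l.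
  by case: {+}n => // n'; rewrite leq_exp2r// /C; nia.
by rewrite expnS expnMn leq_pmul2r ?expn_gt0// /M ltnn.
Qed.

End AffineDimension.

(** * Maximal minors of a matrix of corank one *)

Section Minors.
Variable k : fieldType.

(** Multiplying a matrix by [sel_mx l] on the right selects its columns [l 0, l 1, ...]. *)
Definition sel_mx m n (l : 'I_m -> 'I_n) : 'M[k]_(n, m) :=
  \matrix_(a, b) (a == l b)%:R.

(** The cofactor of the entry [i] of the first column in a matrix whose other columns form
    [sel_mx l]. *)
Definition minor_coef m (l : 'I_m -> 'I_m.+1) (i : 'I_m.+1) : k :=
  (-1) ^+ i * \det (row' i (sel_mx l)).

Lemma minor_coef_lift m (i j : 'I_m.+1) :
  minor_coef (lift i) j = if i == j then (-1) ^+ i else 0.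
Proof.
rewrite /minor_coef; case: eqVneq => [<-|ij].
  rewrite (_ : row' _ _ = 1%:M) ?det1 ?mulr1//.
  by apply/matrixP => a b; rewrite !mxE (inj_eq lift_inj).
rewrite eq_sym in ij; have [a iE _] := unlift_some ij.
rewrite (expand_det_row _ a) big1 ?mulr0// => b _.
by rewrite !mxE -iE (negPf (neq_lift _ _)) mul0r.
Qed.

Lemma det_row_sel m (l : 'I_m -> 'I_m.+1) (phi : 'cV[k]_m.+1) :
  \det (row_mx phi (sel_mx l) : 'M_(1 + m)) = \sum_i phi i 0 * minor_coef l i.
Proof.
rewrite (expand_det_col _ (lshift m 0)); apply: eq_bigr => i _.
rewrite row_mxEl /cofactor addn0 /minor_coef; congr (_ * (_ * \det _)).
apply/matrixP => a b; rewrite 2![LHS]mxE.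
rewrite (_ : lift _ b = rshift 1 b); last exact: val_inj.
by rewrite row_mxEr !mxE.
Qed.

(** Complete [M] by a row [psi] with [psi *m phi = 1] to a square matrix [N]. Then [N] times the
    matrix with columns [phi] and [sel_mx l] is block triangular with diagonal blocks 1 and the
    selected minor. Taking determinants gives the formula with the constant [\det N], independent of
    [l]. *)
Lemma maximal_minors m (M : 'M[k]_(m, m.+1)) (phi : 'cV_m.+1) :
  row_free M -> phi != 0 -> M *m phi = 0 ->
  exists2 c, c != 0 & forall l : 'I_m -> 'I_m.+1,
    \det (\matrix_(i, j) M i (l j)) = c * \sum_i phi i 0 * minor_coef l i.
Proof.
move=> frM phi0 Mphi.
have [psi psiphi] : exists psi : 'rV_m.+1, psi *m phi = 1%:M.
  have [i phii] : exists i, phi i 0 != 0.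
    apply/existsP; apply: contra_neqT phi0; rewrite negb_exists => /forallP h.
    by apply/colP => i; apply/eqP; rewrite mxE; have := h i; rewrite negbK.
  exists ((phi i 0)^-1 *: delta_mx 0 i); rewrite -scalemxAl -rowE.
  by apply/matrixP => a b; rewrite !ord1 !mxE eqxx mulVf.
pose N : 'M_(1 + m, 1 + m) := col_mx psi M.
(* For a row vector killed by [N], multiplication by [phi] shows that its first entry is zero; the
   other entries vanish because [M] is row free. *)
have detN : \det N != 0.
  rewrite -unitfE -[_ \is a _]/(N \in unitmx) -row_free_unit -kermx_eq0.
  apply/rowV0P => v /sub_kermxP; rewrite -[v]hsubmxK mul_row_col => vN.
  have := congr1 (mulmx^~ phi) vN;
    rewrite mulmxDl -!mulmxA Mphi mulmx0 addr0 mul0mx.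
  rewrite psiphi mulmx1 => v0; move: vN; rewrite v0 mul0mx add0r => /eqP.
  by rewrite mulmx_free_eq0// => /eqP ->; rewrite row_mx0.
exists (\det N) => // l; rewrite -det_row_sel -det_mulmx.
rewrite mul_mx_row !mul_col_mx psiphi Mphi -block_mxEh det_ublock det1 mul1r;
  congr (\det _).
apply/matrixP => i j; rewrite !mxE (bigD1 (l j))//= !mxE eqxx mulr1 big1 ?addr0//.
by move=> a /negPf aj; rewrite !mxE aj mulr0.
Qed.

(** Here [n] is only propositionally [m.+1], as for the dimension of a space. The selection [sk i]
    omits the column [i], so that its minor is a nonzero multiple of the coordinate [i] of [phi]. *)
Lemma maximal_minors_linear m n : n = m.+1 ->
  exists (eps : {ffun 'I_m -> 'I_n} -> 'I_n -> k) (sk : 'I_n -> {ffun 'I_m ->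
    'I_n}),
  (forall i j, (eps (sk i) j != 0) = (i == j)) /\
  forall (M : 'M_(m, n)) (phi : 'cV_n), row_free M -> phi != 0 -> M *m phi = 0 ->
    exists2 c, c != 0 & forall l : {ffun 'I_m -> 'I_n},
      \det (\matrix_(i, j) M i (l j)) = c * \sum_i phi i 0 * eps l i.
Proof.
move=> ->; exists (fun l => minor_coef l), (fun i => [ffun j => lift i j]); split.
  move=> i j; rewrite (_ : minor_coef _ j = minor_coef (lift i) j).
    by rewrite minor_coef_lift; case: (i == j); rewrite ?eqxx ?signr_eq0.
  by rewrite /minor_coef; congr (_ * \det _); apply/matrixP => a b;
    rewrite !mxE ffunE.
move=> M phi frM phi0 Mphi; have [c c0 cM] := maximal_minors frM phi0 Mphi.
by exists c.
Qed.

End Minors.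

(** * Linearly embedded projective spaces in a Grassmannian *)

Section Nonvanishing.
Variables (k : closedFieldType) (n : nat).
Implicit Types p q : {mpoly k[n]}.

Lemma meval_line p (u v : 'I_n -> k) :
  exists P : {poly k}, forall t, P.[t] = p.@[fun i => u i + t * (v i - u i)].
Proof.
exists (mmap (@polyC k) (fun i => (u i)%:P + 'X * (v i - u i)%:P) p) => t.
rewrite mevalE /mmap horner_sum; apply: eq_bigr => m _.
rewrite hornerCM /mmap1 horner_prod; congr (_ * _); apply: eq_bigr => i _.
by rewrite horner_exp !hornerE.
Qed.

(** On the line through [u] and [v] both polynomials restrict to nonzero polynomials in one
    variable, and their product has a non-root over the infinite field [k]. *)
Lemma mevalM_neq0 p q u v : p.@[u] != 0 -> q.@[v] != 0 ->
  exists w, p.@[w] != 0 /\ q.@[w] != 0.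
Proof.
have [P hP] := meval_line p u v; have [P' hP'] := meval_line q u v => pu qv.
have : P * P' != 0.
  rewrite mulf_neq0//.
    apply: contraNneq pu => P0; have := hP 0; rewrite P0 horner0 => p0.
    by rewrite [eqbRHS]p0; apply/eqP/meval_eq => i; rewrite mul0r addr0.
  apply: contraNneq qv => P0; have := hP' 1; rewrite P0 horner0 => p0.
  by rewrite [eqbRHS]p0; apply/eqP/meval_eq => i; rewrite mul1r addrC subrK.
case/closed_nonrootP => t; rewrite rootM negb_or /root hP hP' => /andP[].
by exists (fun i => u i + t * (v i - u i)).
Qed.

End Nonvanishing.

Section ZeroLocus.
Variables (k : fieldType) (V : vectType k) (m : nat).

Lemma closed_zero_locus (S : set {mpoly k[nplucker V m]}) :
  S `<=` @homogeneous k _ -> closed (zero_locus S).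
Proof.
move=> homS; apply/zariski_closedE => m'; have [<-|mm'] := eqVneq m m'.
  by exists S; split=> //; apply/seteqP; split=> U; [case | move=> ZU;
    split=> //; case: ZU].
(* On the other Grassmannians the locus is empty, hence cut out by the constant 1. *)
exists [set 1]; split; first by move=> _ ->; exists 0%N; apply: dhomog1.
apply/seteqP; split=> U.
  by case=> -[mU _] m'U; case/eqP: mm'; rewrite -mU -m'U.
by case=> _ /(_ 1 erefl) /eqP; rewrite meval1 oner_eq0.
Qed.

Lemma dhomog_meval_scale (n d : nat) (p : {mpoly k[n]}) (c : k) (u v : 'I_n -> k) :
  p \is d.-homog -> (forall i, u i = c * v i) -> p.@[u] = c ^+ d * p.@[v].
Proof.
move=> /dhomogP homp uv; rewrite !mevalE mulr_sumr big_seq [RHS]big_seq.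
apply: eq_bigr => e /homp; rewrite /= mdegE => <-.
rewrite mulrCA; congr (_ * _); rewrite expr_sum -big_split/=.
by apply: eq_bigr => i _; rewrite uv exprMn.
Qed.

End ZeroLocus.

(** * Linear charts and the transport of equations along them *)

Section LinearChart.
Variables (k : fieldType) (V : vectType k) (m N : nat).
Variable h : 'rV[k]_N -> grassmannian V.

(* The points [h w] form a linearly embedded P^(N-1): up to a scalar, the
   Pluecker coordinates of [h w] are linear forms in [w], and conversely. *)
Record linear_chart (L : 'M[k]_(N, nplucker V m)) (G : 'M[k]_(nplucker V m, N)) :=
  LinearChart {
    chartK : L *m G = 1%:M;
    chart_Gr : forall w, w != 0 -> Gr m (h w);
    chart_plucker : forall w, w != 0 ->
      exists2 c, c != 0 & forall j, plucker (h w) j = c * (w *m L) 0 j;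
    chartZ : forall c w, c != 0 -> h (c *: w) = h w
  }.

Definition chart_image := [set h w | w in [set w | w != 0]].

Variables (L : 'M[k]_(N, nplucker V m)) (G : 'M[k]_(nplucker V m, N)).
Hypothesis hLG : linear_chart L G.

(** Substitution of the linear forms [w *m L] for the Pluecker variables: the equation [p] becomes
    an equation in the parameter [w]. *)
Definition pull (p : {mpoly k[nplucker V m]}) : {mpoly k[N]} :=
  p \mPo [tuple \sum_i L i j *: 'X_i | j < nplucker V m].

Lemma meval_pull p (w : 'rV_N) : (pull p).@[w 0] = p.@[(w *m L) 0].
Proof.
rewrite comp_mpoly_meval; apply: meval_eq => j.
rewrite tnth_mktuple raddf_sum/= mxE; apply: eq_bigr => i _.
by rewrite mevalZ mevalXU mulrC.
Qed.

Lemma meval_plucker_eq0 p w : homogeneous p -> w != 0 ->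
  (p.@[plucker (h w)] == 0) = ((pull p).@[w 0] == 0).
Proof.
move=> [d hp] w0; have [c c0 hc] := chart_plucker hLG w0.
by rewrite (dhomog_meval_scale hp hc) meval_pull mulf_eq0 expf_eq0 (negPf c0) andbF.
Qed.

(** Since [L *m G = 1], this linear form in the Pluecker variables reads off the coordinate [i] of
    [w]. *)
Definition coord_form (i : 'I_N) : {mpoly k[nplucker V m]} := \sum_j G j i *: 'X_j.

Lemma dhomog_coord_form i : coord_form i \is 1.-homog.
Proof. by apply: rpred_sum => j _; rewrite rpredZ// dhomogX/= mdeg1. Qed.

Lemma meval_coord_form i (w : 'rV_N) : (coord_form i).@[(w *m L) 0] = w 0 i.
Proof.
rewrite raddf_sum/= -[in RHS](mulmx1 w) -(chartK hLG) mulmxA [in RHS]mxE.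
by apply: eq_bigr => j _; rewrite mevalZ mevalXU mulrC.
Qed.

(** Each variable is replaced by its [coord_form], and each monomial is completed to the common
    degree [msize q] by powers of the form of [i0], which takes the value 1 on the affine chart. *)
Lemma homogenize (q : {mpoly k[N]}) (i0 : 'I_N) :
  exists2 p : {mpoly k[nplucker V m]}, homogeneous p &
    forall w : 'rV_N, w 0 i0 = 1 -> (pull p).@[w 0] = q.@[w 0].
Proof.
pose d := msize q.
exists (\sum_(e <- msupp q) q@_e *:
  ((\prod_i coord_form i ^+ e i) * coord_form i0 ^+ (d - mdeg e))).
  exists d; rewrite big_seq; apply: rpred_sum => e /msize_mdeg_lt lte.
  rewrite rpredZ// -[X in _ \is X.-homog](subnKC (ltnW lte)) dhomogM//; last first.
    by have := dhomogMn (d - mdeg e) (dhomog_coord_form i0); rewrite mul1n.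
  rewrite mdegE; apply: (big_rec2 (fun (x : {mpoly k[_]}) y => x \is y.-homog)).
    exact: dhomog1.
  move=> i x y _ hx; rewrite dhomogM//.
  by have := dhomogMn (e i) (dhomog_coord_form i); rewrite mul1n.
move=> w w1; rewrite meval_pull raddf_sum mevalE/=; apply: eq_bigr => e _.
rewrite mevalZ mevalM rmorphXn/= meval_coord_form w1 expr1n mulr1 rmorph_prod/=.
by congr (_ * _); apply: eq_bigr => i _; rewrite rmorphXn/= meval_coord_form.
Qed.

End LinearChart.

Section ClosedSets.
Variables (k : fieldType) (V : vectType k) (m : nat).

Lemma closed_form (F : set (grassmannian V)) : closed F ->
  exists2 S : set {mpoly k[nplucker V m]}, S `<=` @homogeneous k _ &
    forall U, Gr m U -> F U <-> forall p, S p -> p.@[plucker U] = 0.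
Proof.
move=> /zariski_closedE/(_ m)[S [homS eS]]; exists S => // U mU.
have /seteqP[/(_ U) FS /(_ U) SF] := eS; split=> [FU|US].
  by have [] := FS (conj FU mU).
by have [] := SF (conj mU US).
Qed.

End ClosedSets.

(** * Irreducibility of the image of a linear chart *)

Section ChartIrreducible.
Variables (k : closedFieldType) (V : vectType k) (m N : nat).
Variables (h : 'rV[k]_N -> grassmannian V).
Variables (L : 'M[k]_(N, nplucker V m)) (G : 'M[k]_(nplucker V m, N)).
Hypothesis hLG : linear_chart h L G.

Let row_of (u : 'I_N -> k) : 'rV[k]_N := \row_i u i.

Let meval_row_of p u : p.@[u] = p.@[row_of u 0].
Proof. by apply: meval_eq => i; rewrite mxE. Qed.

Lemma row_neq0P (w : 'rV[k]_N) : w != 0 -> exists i, w 0 i != 0.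
Proof.
move=> w0; apply/existsP; apply: contra_neqT w0; rewrite negb_exists => /forallP hw.
by apply/rowP => i; apply/eqP; rewrite mxE -[_ == _]negbK.
Qed.

(** Within [Gr m] the set [F] is cut out by homogeneous equations; one of them fails at [h w]. *)
Lemma closed_separation F w : closed F -> w != 0 -> ~ F (h w) ->
  exists2 p, homogeneous p & (pull L p).@[w 0] != 0 /\
    forall w', w' != 0 -> F (h w') -> (pull L p).@[w' 0] = 0.
Proof.
move=> /(closed_form m)[S homS hS] w0 Fw.
have /existsNP[p /not_implyP[Sp /eqP pw]] : ~ forall p, S p -> p.@[plucker (h w)]
  = 0.
  by move=> H; apply: Fw; apply/(hS _ (chart_Gr hLG w0)).
exists p; first exact: homS.
rewrite -(meval_plucker_eq0 hLG)//; last exact: homS.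
split=> // w' w'0 Fw'; apply/eqP; rewrite -(meval_plucker_eq0 hLG)//;
  last exact: homS.
by apply/eqP; move: p Sp {pw}; apply/(hS _ (chart_Gr hLG w'0)).
Qed.

Lemma chart_irreducible : (0 < N)%N -> irreducible (chart_image h).
Proof.
move=> N0; split.
  pose i0 := Ordinal N0; exists (h (delta_mx 0 i0)), (delta_mx 0 i0) => //=.
  by apply/eqP => /rowP/(_ i0)/eqP; rewrite !mxE !eqxx oner_eq0.
move=> F F' cF cF' sub; apply: contrapT => /not_orP[nF nF'].
have nsub A : ~ chart_image h `<=` A -> exists2 w, w != 0 & ~ A (h w).
  move=> /existsNP[_ /not_implyP[[w w0 <-] nA]].
  by exists w.
have [w1 w10 F1] := nsub F nF; have [w2 w20 F2] := nsub F' nF'.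
have [p homp [pw1 pF]] := closed_separation cF w10 F1.
have [q homq [qw2 qF]] := closed_separation cF' w20 F2.
have [i w1i] := row_neq0P w10.
(* The extra factor ['X_i] keeps the common point of nonvanishing away from the origin, which is not
   a parameter. *)
have Xw1 : ('X_i : {mpoly k[N]}).@[w1 0] != 0 by rewrite mevalXU.
have [u [pu qu]] := mevalM_neq0 pw1 qw2.
have pqu : (pull L p * pull L q).@[u] != 0 by rewrite mevalM mulf_neq0.
have [v [pqv]] := mevalM_neq0 pqu Xw1.
rewrite mevalXU => vi; move: pqv; rewrite meval_row_of mevalM.
have v0 : row_of v != 0.
  by apply: contraNneq vi => v0; have /rowP/(_ i) := v0; rewrite !mxE => ->.
have [|Fv|Fv] := sub (h (row_of v)); first by exists (row_of v).
  by rewrite pF// mul0r eqxx.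
by rewrite qF// mulr0 eqxx.
Qed.

End ChartIrreducible.

(** * Upper bound for the dimension of the image of a linear chart *)

Section ChartDimension.
Variables (k : closedFieldType) (V : vectType k) (m N : nat).
Variables (h : 'rV[k]_N.+1 -> grassmannian V).
Variables (L : 'M[k]_(N.+1, nplucker V m)) (G : 'M[k]_(nplucker V m, N.+1)).
Hypothesis hLG : linear_chart h L G.
Local Notation X := (chart_image h).

(** The standard affine chart of the projective space on which the coordinate [i0] is normalized to
    1. *)
Let emb (i0 : 'I_N.+1) (u : 'I_N -> k) : 'rV[k]_N.+1 :=
  \row_i if unlift i0 i is Some j then u j else 1.

Let emb1 i0 (u : 'I_N -> k) : emb i0 u 0 i0 = 1.
Proof. by rewrite mxE unlift_none. Qed.

Let emb_neq0 i0 u : emb i0 u != 0.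
Proof.
apply/eqP => /(congr1 (fun w : 'rV[k]_N.+1 => w 0 i0))/eqP.
by rewrite emb1 mxE oner_eq0.
Qed.

Let embP i0 (w : 'rV[k]_N.+1) : w 0 i0 = 1 -> exists u, w = emb i0 u.
Proof.
move=> w1; exists (fun j => w 0 (lift i0 j)); apply/rowP => i.
by rewrite mxE; case: unliftP => [j ->//|->].
Qed.

(** The dehomogenization of [p] with respect to the coordinate [i0]. *)
Let affine_part i0 (p : {mpoly k[nplucker V m]}) : {mpoly k[N]} :=
  pull L p \mPo [tuple if unlift i0 i is Some j then 'X_j else 1 | i < N.+1].

Let meval_affine i0 p u : (affine_part i0 p).@[u] = (pull L p).@[emb i0 u 0].
Proof.
rewrite comp_mpoly_meval; apply: meval_eq => i; rewrite tnth_mktuple mxE.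
by case: unlift => [j|]; rewrite ?mevalXU ?meval1.
Qed.

Let hyper (p : {mpoly k[nplucker V m]}) : set (grassmannian V) :=
  zero_locus [set p].

Let closed_hyper p : homogeneous p -> closed (hyper p).
Proof. by move=> homp; apply: closed_zero_locus => _ ->. Qed.

Let hyperE p w : homogeneous p -> w != 0 ->
  hyper p (h w) <-> (pull L p).@[w 0] = 0.
Proof.
move=> homp w0; split.
  by move=> [_ /(_ p erefl)/eqP]; rewrite (meval_plucker_eq0 hLG)// => /eqP.
move=> /eqP pw; split; first exact: (chart_Gr hLG).
by move=> _ ->; apply/eqP; rewrite (meval_plucker_eq0 hLG).
Qed.

Lemma chart_has_chain_le r : has_chain X r -> (r <= N)%N.
Proof.
move=> [Z [Zcirr ltZ]].
have ZX i : (i <= r)%N -> Z i `<=` X by move=> /Zcirr[[F _ ->] _] U [].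
have ZZ i : (i <= r)%N -> Z 0%N `<=` Z i.
  elim: i => [_ x //|i IHi lti x /(IHi (ltnW lti))].
  by case: (ltZ i lti) => sub _; apply: sub.
have [_ [[x0 Z0x0] _]] := Zcirr 0%N (leq0n _).
have [w0 w0n0 hw0] := ZX 0%N (leq0n _) _ Z0x0.
(* The chain is increasing, so the affine chart around a point of [Z 0] meets every [Z i]. *)
have [i0 w0i0] := row_neq0P w0n0.
have ell0 w : w != 0 -> hyper (coord_form G i0) (h w) <-> w 0 i0 = 0.
  move=> wn0; rewrite hyperE//; last by exists 1%N; apply: dhomog_coord_form.
  by rewrite meval_pull (meval_coord_form hLG).
have closed_ell : closed (hyper (coord_form G i0)).
  by apply: closed_hyper; exists 1%N; apply: dhomog_coord_form.
pose Y i := [set u | Z i (h (emb i0 u))].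
(* An irreducible [Z i], which meets the affine chart, is the closure of its
   intersection with that chart. *)
have dense i p : (i <= r)%N -> homogeneous p ->
    vanishes (Y i) (affine_part i0 p) -> Z i `<=` hyper p.
  move=> lei homp pY; have [_ [_ irrZ]] := Zcirr i lei.
  case: (irrZ _ _ (closed_hyper homp) closed_ell) => // [U ZU|Zell].
    have [w wn0 hw] := ZX i lei _ ZU; rewrite -{}hw in ZU *.
    have [wi0|wi0] := eqVneq (w 0 i0) 0; first by right; apply/ell0.
    left; rewrite -(chartZ hLG (c := (w 0 i0)^-1)) ?invr_eq0// in ZU *.
    have [|u eu] := @embP i0 ((w 0 i0)^-1 *: w); first by rewrite mxE mulVf.
    rewrite eu in ZU *; apply/hyperE => //; rewrite -meval_affine.
    exact: pY.
  have := Zell _ (ZZ i lei _ Z0x0).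
  by rewrite -hw0 => /(ell0 _ w0n0)/eqP; rewrite (negPf w0i0).
(* An equation of [Z i] that fails somewhere on [Z i.+1]; its affine part still fails on [Y i.+1],
   by density. *)
have exf i : exists p : {mpoly k[nplucker V m]}, (i < r)%N ->
    [/\ homogeneous p, Z i `<=` hyper p & ~ Z i.+1 `<=` hyper p].
  have [lti|] := boolP (i < r)%N; last by exists 0.
  have [[F cF ZF] _] := Zcirr i (ltnW lti).
  have [_ /existsNP[x /not_implyP[Zx nZx]]] := ltZ i lti.
  have [w wn0 hw] := ZX i.+1 lti _ Zx.
  have nF : ~ F (h w) by rewrite hw => Fx; apply: nZx; rewrite ZF; split=> //;
    apply: ZX Zx.
  have [p homp [pw pF]] := closed_separation hLG cF wn0 nF.
  exists p => _; split=> //.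
    move=> y Zy; have [w' w'n0 hw'] := ZX i (ltnW lti) _ Zy; rewrite -hw'.
    by apply/hyperE => //; apply: pF => //; rewrite hw'; move: Zy;
      rewrite ZF => -[].
  by move=> /(_ _ Zx); rewrite -hw => /(hyperE homp wn0)/eqP; rewrite (negPf pw).
have [f hf] := choice exf.
apply: (@affine_chain_le k N r Y (fun i => affine_part i0 (f i))).
- have [|u eu] := @embP i0 ((w0 0 i0)^-1 *: w0); first by rewrite mxE mulVf.
  by exists u; rewrite /Y/= -eu (chartZ hLG) ?invr_eq0// hw0.
(* [Y i] is prime: homogenizing [p] and [q] covers [Z i] by two hypersurfaces, and the irreducible
   [Z i] lies in one of them. *)
- move=> i lei p q pq.
  pose lft (p : {mpoly k[N]}) : {mpoly k[N.+1]} := p \mPo [tuple 'X_(lift i0 j) |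
    j < N].
  have lftE p' u : (lft p').@[emb i0 u 0] = p'.@[u].
    rewrite comp_mpoly_meval; apply: meval_eq => j.
    by rewrite tnth_mktuple mevalXU mxE liftK.
  have [p' homp' p'E] := homogenize hLG (lft p) i0.
  have [q' homq' q'E] := homogenize hLG (lft q) i0.
  have Z_pq : Z i `<=` hyper p' `|` hyper q'.
    have : Z i `<=` hyper (p' * q').
      apply: dense => //.
        case: homp' homq' => [d hd] [e he]; exists (d + e)%N; exact: dhomogM.
      move=> u Yu; rewrite meval_affine /pull rmorphM/= mevalM -/(pull _ _).
      by rewrite p'E// q'E// !lftE -mevalM pq.
    move=> sub U /sub[mU /(_ _ erefl)/eqP]; rewrite mevalM mulf_eq0 => /orP[]/eqP e.
      by left; split=> // _ ->.
    by right; split=> // _ ->.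
  have [_ [_ irrZ]] := Zcirr i lei.
  case: (irrZ _ _ (closed_hyper homp') (closed_hyper homq') Z_pq) => sub.
    by left=> u Yu; rewrite -lftE -p'E//; apply/hyperE => //; apply: sub.
  by right=> u Yu; rewrite -lftE -q'E//; apply/hyperE => //; apply: sub.
- move=> i lti; have [homf Zf nZf] := hf i lti; split.
  + by move=> u; case: (ltZ i lti) => sub _; apply: sub.
  + by move=> u Yu; rewrite meval_affine; apply/hyperE => //; apply: Zf.
  + by move=> vf; apply: nZf; apply: dense.
Qed.

End ChartDimension.

(** * Isomorphisms between the images of two linear charts *)

Section ChartIso.
Variables (k : fieldType) (V W : vectType k) (m m' N : nat).
Variables (h : 'rV[k]_N -> grassmannian V) (h' : 'rV[k]_N -> grassmannian W).
Variables (L : 'M[k]_(N, nplucker V m)) (G : 'M[k]_(nplucker V m, N)).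
Variables (L' : 'M[k]_(N, nplucker W m')) (G' : 'M[k]_(nplucker W m', N)).
Hypotheses (hLG : linear_chart h L G) (hLG' : linear_chart h' L' G').

Lemma chart_inj (v w : 'rV[k]_N) : v != 0 -> w != 0 -> h v = h w ->
  exists2 c, c != 0 & v = c *: w.
Proof.
move=> v0 w0 hvw; have [c c0 hc] := chart_plucker hLG v0.
have [d d0 hd] := chart_plucker hLG w0; exists (d / c);
  first by rewrite mulf_neq0 ?invr_eq0.
rewrite -[v]mulmx1 -[w]mulmx1 -(chartK hLG) !mulmxA scalemxAl; congr (_ *m _).
apply/rowP => j; rewrite [RHS]mxE; apply: (mulfI c0).
by rewrite -hc hvw hd mulrA (mulrC c) divfK.
Qed.

(** On the image of [h], the matrix [G] recovers the parameter of [U] up to a nonzero scalar, which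
    [h'] ignores. *)
Definition transition (U : grassmannian V) : grassmannian W :=
  h' (\row_j plucker U j *m G).

Lemma transitionE (w : 'rV[k]_N) : w != 0 -> transition (h w) = h' w.
Proof.
move=> w0; have [c c0 hc] := chart_plucker hLG w0.
rewrite /transition (_ : \row_j _ = c *: (w *m L)); last first.
  by apply/rowP => j; rewrite mxE hc [RHS]mxE.
by rewrite -scalemxAl -mulmxA (chartK hLG) mulmx1 (chartZ hLG').
Qed.

(** The linear forms given by [G *m L'] describe the map everywhere, so the neighbourhood can be the
    whole space and the degree 1. *)
Lemma regular_transition : regular_map m m' (chart_image h) transition.
Proof.
move=> U _; exists setT; split=> //; first exact: openT.
exists 1%N, (fun j => \sum_i (G *m L') i j *: 'X_i); split.
  by move=> j; apply: rpred_sum => i _; rewrite rpredZ// dhomogX/= mdeg1.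
move=> _ [w w0 <-] _; rewrite transitionE//.
have [c c0 hc] := chart_plucker hLG w0; have [d d0 hd] := chart_plucker hLG' w0.
exists (c / d) => [|j]; first by rewrite mulf_neq0 ?invr_eq0.
rewrite raddf_sum/= hd mulrA divfK// -[w in RHS]mulmx1 -(chartK hLG) -!mulmxA
  mulmxA.
rewrite [in RHS]mxE mulr_sumr; apply: eq_bigr => i _.
by rewrite mevalZ mevalXU hc mulrC mulrA.
Qed.

End ChartIso.

Lemma chart_isomorphic (k : fieldType) (V W : vectType k) (m m' N : nat) h h'
    (L : 'M[k]_(N, nplucker V m)) (G : 'M[k]_(nplucker V m, N))
    (L' : 'M[k]_(N, nplucker W m')) (G' : 'M[k]_(nplucker W m', N)) :
  linear_chart h L G -> linear_chart h' L' G' ->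
  isomorphic m m' (chart_image h) (chart_image h').
Proof.
move=> hLG hLG'; split; first by move=> _ [w w0 <-]; apply: (chart_Gr hLG).
split; first by move=> _ [w w0 <-]; apply: (chart_Gr hLG').
exists (transition h' G), (transition h G'); split.
- exact: (regular_transition hLG hLG').
- exact: (regular_transition hLG' hLG).
- move=> _ [w w0 <-]; rewrite (transitionE hLG hLG')// (transitionE hLG' hLG)//.
  by split=> //; exists w.
- move=> _ [w w0 <-]; rewrite (transitionE hLG' hLG)// (transitionE hLG hLG')//.
  by split=> //; exists w.
Qed.

(** A minor of size one is a coordinate, so the Pluecker vector of a line is proportional to the
    coordinate vector of a generator. [L] is the change from the standard basis to [vbasis], hence
    has a right inverse. *)
Lemma line_chart (k : fieldType) n : exists L G,
  @linear_chart k 'rV[k]_n 1 n (fun w => <[w]>%VS) L G.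
Proof.
pose L : 'M[k]_(n, nplucker 'rV[k]_n 1) := \matrix_(i, j)
  coord (vbasis {:'rV[k]_n}) ((enum_val j : plucker_index 'rV[k]_n 1) ord0)
    (delta_mx 0 i).
have LE (w : 'rV[k]_n) j : (w *m L) 0 j =
    coord (vbasis {:'rV[k]_n}) ((enum_val j : plucker_index 'rV[k]_n 1) ord0) w.
  rewrite [w in RHS]row_sum_delta linear_sum !mxE; apply: eq_bigr => i _.
  by rewrite linearZ/= mxE.
have /row_freeP[G LG] : row_free L.
  rewrite -kermx_eq0; apply/rowV0P => w /sub_kermxP wL.
  rewrite (coord_vbasis (memvf w)) big1// => i _.
  have := LE w (enum_rank [ffun=> i]); rewrite enum_rankK ffunE wL mxE => <-.
  by rewrite scale0r.
exists L, G; split=> //.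
- by move=> w w0; rewrite /Gr/= dim_vline w0.
- move=> w w0.
  have dw : \dim <[w]>%VS = 1%N by rewrite dim_vline w0.
  have b0 : (vbasis <[w]>%VS)`_0 != 0.
    by apply: (basis_not0 (vbasisP <[w]>%VS)); rewrite mem_nth// size_tuple dw.
  have /vlineP[c bE] : (vbasis <[w]>%VS)`_0 \in <[w]>%VS.
    by apply: vbasis_mem; rewrite mem_nth// size_tuple dw.
  exists c; first by apply: contraNneq b0 => c0; rewrite bE c0 scale0r.
  by move=> j; rewrite /plucker det_mx11 mxE bE linearZ LE.
- move=> c w c0; apply/eqP; rewrite eqEsubv -!memvE memvZ ?memv_line//=.
  by rewrite -[X in X \in _](scalerK c0) memvZ ?memv_line.
Qed.

Lemma line_chart_image (k : fieldType) n :
  chart_image (fun w : 'rV[k]_n => <[w]>%VS : grassmannian _) = @Gr k 'rV[k]_n 1.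
Proof.
apply/seteqP; split=> [_ [w w0 <-]|U dU]; first by rewrite /Gr/= dim_vline w0.
exists (vpick U); first by rewrite /= vpick0 -dimv_eq0 dU.
apply/eqP; rewrite eqEdim -memvE memv_pick dU dim_vline vpick0 -dimv_eq0 dU.
by [].
Qed.

(** * Linear subspaces of the projective space of a chart *)

Section SubImage.
Variables (k : fieldType) (V : vectType k) (m N : nat).
Variables (h : 'rV[k]_N -> grassmannian V).
Variables (L : 'M[k]_(N, nplucker V m)) (G : 'M[k]_(nplucker V m, N)).
Hypothesis hLG : linear_chart h L G.
Hypothesis hGr : Gr m `<=` chart_image h.

Definition sub_image n (A : 'M[k]_(n, N)) : set (grassmannian V) :=
  [set U | exists v, [/\ v != 0, (v <= A)%MS & U = h v]].

Lemma sub_image_subset n n' (A : 'M_(n, N)) (B : 'M_(n', N)) :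
  sub_image A `<=` sub_image B <-> (A <= B)%MS.
Proof.
split=> [AB|AB _ [v [v0 vA ->]]]; last by exists v; split=> //;
  apply: submx_trans AB.
apply/rV_subP => v vA; have [->|v0] := eqVneq v 0; first exact: sub0mx.
have [|w [w0 wB hvw]] := AB (h v); first by exists v.
have [c c0 ->] := chart_inj hLG v0 w0 hvw.
by rewrite scalemx_sub.
Qed.

Lemma sub_image_eqmx n n' (A : 'M_(n, N)) (B : 'M_(n', N)) :
  (A :=: B)%MS -> sub_image A = sub_image B.
Proof. by move=> AB; apply/seteqP; split; apply/sub_image_subset; rewrite AB. Qed.

Lemma sub_image_chart n (A : 'M_(n, N)) : row_free A ->
  sub_image A = chart_image (fun w => h (w *m A)).
Proof.
move=> frA; apply/seteqP; split=> [_ [v [v0 /submxP[w vE] ->]]|_ [w w0 <-]].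
  exists w; last by rewrite -vE.
  by apply: contraNneq v0 => w0; rewrite vE w0 mul0mx.
by exists (w *m A); rewrite submxMl mulmx_free_eq0.
Qed.

(** If [R] is a right inverse of [A], then [(A *m L) *m (G *m R) = A *m R = 1]. *)
Lemma linear_chart_mulmx n (A : 'M_(n, N)) : row_free A ->
  exists L' G', linear_chart (m := m) (fun w => h (w *m A)) L' G'.
Proof.
move=> frA; have /row_freeP[R AR] := frA; exists (A *m L), (G *m R); split.
- by rewrite mulmxA -(mulmxA A) (chartK hLG) mulmx1.
- by move=> w w0; apply: (chart_Gr hLG); rewrite mulmx_free_eq0.
- move=> w w0; have [|c c0 hc] := chart_plucker hLG (w := w *m A).
    by rewrite mulmx_free_eq0.
  by exists c => // j; rewrite hc mulmxA.
- by move=> c w c0; rewrite -scalemxAl (chartZ hLG).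
Qed.

(** The row space of [A] is the kernel of [cokermx A]; composing with [G] turns these conditions
    into linear equations in the Pluecker coordinates. They cut out nothing more, because [h]
    reaches all of [Gr m]. *)
Lemma closed_sub_image n (A : 'M_(n, N)) : closed (sub_image A).
Proof.
pose p l : {mpoly k[nplucker V m]} := \sum_j (G *m cokermx A) j l *: 'X_j.
have -> : sub_image A = zero_locus [set p l | l in setT].
  have pE v l : v != 0 -> exists2 c, c != 0 & (p l).@[plucker (h v)] = c * (v *m
    cokermx A) 0 l.
    move=> v0; have [c c0 hc] := chart_plucker hLG v0; exists c => //.
    rewrite raddf_sum/= -[v in RHS]mulmx1 -(chartK hLG) -!mulmxA mulmxA.
    rewrite [in RHS]mxE mulr_sumr; apply: eq_bigr => i _.
    by rewrite mevalZ mevalXU hc mulrC mulrA.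
  apply/seteqP; split=> [_ [v [v0 vA ->]]|U [/hGr[v v0 <-] hp]].
    split; first exact: (chart_Gr hLG).
    move=> _ [l _ <-]; have [c _ ->] := pE v l v0.
    by move: vA; rewrite submxE => /eqP ->; rewrite mxE mulr0.
  exists v; split=> //; rewrite submxE; apply/eqP/rowP => l; rewrite [RHS]mxE.
  have [c c0 /esym] := pE v l v0; rewrite hp; last by exists l.
  by move/eqP; rewrite mulf_eq0 (negPf c0) => /eqP.
apply: closed_zero_locus => _ [l _ <-]; exists 1%N.
by apply: rpred_sum => i _; rewrite rpredZ// dhomogX/= mdeg1.
Qed.

Lemma row_base_rank n (A : 'M[k]_(n, N)) r : \rank A = r ->
  exists2 A' : 'M_(r, N), row_free A' & (A' :=: A)%MS.
Proof.
move=> <-; exists (row_base A); first exact: row_base_free.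
exact: eq_row_base.
Qed.

Lemma sub_image_projective n (A : 'M_(n, N)) :
  A != 0 -> is_projective_space m (sub_image A).
Proof.
rewrite -mxrank_eq0 -lt0n => rA; exists (\rank A).-1.
have [|A' frA' eA'] := row_base_rank (A := A) (r := (\rank A).-1.+1).
  by rewrite prednK.
have [L' [G' hLG']] := linear_chart_mulmx frA'.
have [L1 [G1 hLG1]] := line_chart k (\rank A).-1.+1.
rewrite -(sub_image_eqmx eA') sub_image_chart// -line_chart_image.
exact: (chart_isomorphic hLG' hLG1).
Qed.

End SubImage.

Section SubImageTopology.
Variables (k : closedFieldType) (V : vectType k) (m N : nat).
Variables (h : 'rV[k]_N -> grassmannian V).
Variables (L : 'M[k]_(N, nplucker V m)) (G : 'M[k]_(nplucker V m, N)).
Hypothesis hLG : linear_chart h L G.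
Hypothesis hGr : Gr m `<=` chart_image h.

Lemma sub_image_irreducible n (A : 'M_(n, N)) : A != 0 -> irreducible (sub_image
  h A).
Proof.
rewrite -mxrank_eq0 -lt0n => rA;
  have [A' frA' eA'] := row_base_rank (erefl (\rank A)).
rewrite -(sub_image_eqmx hLG eA') (sub_image_chart h frA').
have [L' [G' hLG']] := linear_chart_mulmx hLG frA'.
exact: chart_irreducible hLG' rA.
Qed.

(** The upper bound is that of the chart; a full flag of linear subspaces gives a chain of length
    [d]. *)
Lemma sub_image_dimension n (A : 'M_(n, N)) d :
  \rank A = d.+1 -> dimension (sub_image h A) d.
Proof.
move=> /row_base_rank[A' frA' eA']; rewrite -(sub_image_eqmx hLG eA'); split;
  last first.
  have [L' [G' hLG']] := linear_chart_mulmx hLG frA'.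
  by move=> r; rewrite (sub_image_chart h frA'); apply: (chart_has_chain_le hLG').
(* The first [i.+1] rows of the basis [A'], which span a projective space of dimension [i]. *)
pose P i := (pid_mx i.+1 : 'M[k]_(i.+1, d.+1)) *m A'.
have rP i : (i <= d)%N -> \rank (P i) = i.+1.
  by move=> lei; rewrite mxrankMfree// rank_pid_mx.
exists (fun i => sub_image h (P i)); split=> i lei.
  split; last by apply: sub_image_irreducible; rewrite -mxrank_eq0 rP.
  exists (sub_image h (P i));
    first exact: (@closed_sub_image _ _ _ _ _ _ _ hLG hGr _ (P i)).
  by apply/esym/setIidPr/(sub_image_subset hLG)/submxMl.
have sub : (P i <= P i.+1)%MS.
  have -> : P i = (pid_mx i.+1 : 'M_(i.+1, i.+2)) *m P i.+1.
    by rewrite /P mulmxA mul_pid_mx; congr (pid_mx _ *m _); lia.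
  exact: submxMl.
split; first exact/(sub_image_subset hLG).
move=> /(sub_image_subset hLG)/mxrankS; rewrite !rP ?ltnn//; exact: ltnW.
Qed.

End SubImageTopology.

(** * The Grassmannian of hyperplanes *)

Section HyperplaneChart.
Variables (k : fieldType) (V : vectType k) (m : nat).
Hypothesis dimV : \dim {:V} = m.+1.
Local Notation n := (\dim {:V}).
Local Notation b := (vbasis {:V}).

Definition functional (w : 'rV[k]_n) : 'Hom(V, k^o) :=
  \sum_i w 0 i *: linfun (coord b i : V -> k^o).

Lemma functionalE w x : functional w x = \sum_i w 0 i * coord b i x.
Proof. by rewrite sum_lfunE; apply: eq_bigr => i _; rewrite scale_lfunE lfunE. Qed.

Lemma functional_basis w (i : 'I_n) : functional w b`_i = w 0 i.
Proof.
rewrite functionalE (bigD1 i)//= big1 ?addr0 => [|j ji].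
  by rewrite coord_free ?(basis_free (vbasisP _))// eqxx mulr1.
by rewrite coord_free ?(basis_free (vbasisP _))// -val_eqE /= eq_sym
  (negPf (ji : val j != i)) mulr0.
Qed.

Lemma functional_eq0 w : (functional w == 0) = (w == 0).
Proof.
apply/eqP/eqP => [w0|->]; last by rewrite /functional big1// => i _;
  rewrite mxE scale0r.
by apply/rowP => i; rewrite -functional_basis w0 lfunE mxE.
Qed.

Lemma functionalK (f : 'Hom(V, k^o)) : functional (\row_i f b`_i) = f.
Proof.
apply/lfunP => x; rewrite functionalE [in RHS](coord_vbasis (memvf x)) linear_sum.
by apply: eq_bigr => i _; rewrite mxE linearZ mulrC.
Qed.

Lemma functionalZ c w : functional (c *: w) = c *: functional w.
Proof.
by rewrite /functional scaler_sumr; apply: eq_bigr => i _; rewrite mxE scalerA.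
Qed.

Definition hyperplane_of (w : 'rV[k]_n) : grassmannian V := lker (functional w).

Lemma dim_lker_functional (f : 'Hom(V, k^o)) : f != 0 -> \dim (lker f) = m.
Proof.
move=> f0; have := limg_ker_dim f fullv; rewrite capfv dimV.
suff -> : \dim (limg f) = 1%N by rewrite addn1 => -[].
apply/eqP; rewrite eqn_leq; apply/andP; split.
  by apply: leq_trans (dimvS (subvf _)) _; rewrite dimvf.
rewrite lt0n dimv_eq0; apply: contraNneq f0 => limg0; apply/eqP/lfunP => x.
by have := memv_img f (memvf x); rewrite limg0 memv0 lfunE => /eqP.
Qed.

(** The rows are the coordinates of a basis of [U], so the maximal minors are the Pluecker
    coordinates of [U]. *)
Let coord_mx (U : {vspace V}) : 'M[k]_(m, n) :=
  \matrix_(i, j) coord b j (vbasis U)`_i.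

Let coord_mxP (U : {vspace V}) (w : 'rV[k]_n) : Gr m U ->
  coord_mx U *m w^T = 0 <-> (U <= lker (functional w))%VS.
Proof.
move=> mU; have iE (i : 'I_m) : (coord_mx U *m w^T) i 0 = functional w (vbasis
  U)`_i.
  by rewrite mxE functionalE; apply: eq_bigr => j _; rewrite !mxE mulrC.
split=> [U0|/subvP sU]; last first.
  apply/colP => i; rewrite iE mxE; have /sU : (vbasis U)`_i \in U.
    by rewrite vbasis_mem// mem_nth// size_tuple mU.
  by rewrite memv_ker => /eqP.
apply/subvP => x xU; rewrite memv_ker (coord_vbasis xU) linear_sum big1// => i _.
move/colP: U0 => /(_ (cast_ord mU i)); rewrite iE mxE linearZ/= => ->.
by rewrite scaler0.
Qed.

Let row_free_coord_mx (U : {vspace V}) : Gr m U -> row_free (coord_mx U).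
Proof.
move=> mU; rewrite -kermx_eq0; apply/rowV0P => v /sub_kermxP vU.
have /freeP fr := basis_free (vbasisP U).
apply/rowP => i; rewrite [RHS]mxE -(cast_ordKV mU i).
apply: (fr (fun i => v 0 (cast_ord mU i))).
rewrite [LHS](coord_vbasis (memvf _)) big1// => j _.
set y := \sum_i _; have -> : coord b j y = 0; last by rewrite scale0r.
transitivity ((v *m coord_mx U) 0 j); last by rewrite vU mxE.
rewrite linear_sum mxE (reindex (cast_ord mU)) /=; last first.
  by exists (cast_ord (esym mU)) => z _; rewrite ?cast_ordK ?cast_ordKV.
by apply: eq_bigr => l _; rewrite linearZ !mxE.
Qed.

Lemma hyperplane_chart : exists L G, linear_chart (m := m) hyperplane_of L G.
Proof.
have [eps [sk [epsE minors]]] := maximal_minors_linear k dimV.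
pose L : 'M[k]_(n, nplucker V m) := \matrix_(i, j) eps (enum_val j) i.
(* The coordinate [i] is read off the minor selected by [sk i], to which no other coordinate
   contributes. *)
pose G : 'M[k]_(nplucker V m, n) :=
  \matrix_(j, i) ((j == enum_rank (sk i))%:R / eps (sk i) i).
exists L, G; split.
- apply/matrixP => i i'; rewrite mxE (bigD1 (enum_rank (sk i')))//= big1 => [|j ji].
    rewrite !mxE enum_rankK eqxx addr0 mul1r; have := epsE i' i.
    case: (eqVneq i i') => [->|_] e; first by rewrite mulfV.
    by move/negbT: e; rewrite negbK => /eqP ->; rewrite mul0r.
  by rewrite !mxE (negPf ji) mul0r mulr0.
- by move=> w w0; apply: dim_lker_functional; rewrite functional_eq0.
- move=> w w0; have mU : Gr m (hyperplane_of w).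
    by apply: dim_lker_functional; rewrite functional_eq0.
  have [||c c0 hc] := minors (coord_mx (hyperplane_of w)) w^T (row_free_coord_mx
    mU).
    by rewrite -trmx_eq0 trmxK.
    by apply/(coord_mxP w mU).
  exists c => // j; transitivity (c * \sum_i w^T i 0 * eps (enum_val j) i).
    by rewrite -hc; congr (\det _); apply/matrixP => i l; rewrite !mxE.
  by rewrite mxE; congr (_ * _); apply: eq_bigr => i _; rewrite !mxE.
- by move=> c w c0; rewrite /hyperplane_of functionalZ; apply/vspaceP => x;
  rewrite !memv_ker scale_lfunE scaler_eq0 (negPf c0).
Qed.

(** The matrix [coord_mx U] has one more column than rows, so some nonzero functional vanishes on
    [U]; its kernel equals [U] by dimension. *)
Lemma hyperplane_chart_onto : Gr m `<=` chart_image hyperplane_of.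
Proof.
move=> U mU.
have /rowV0Pn[w /sub_kermxP wU w0] : kermx (coord_mx U)^T != 0.
  rewrite kermx_eq0 /row_free mxrank_tr neq_ltn (leq_ltn_trans (rank_leq_row _))//.
  by rewrite dimV.
exists w => //; apply/esym/eqP.
rewrite eqEdim dim_lker_functional ?functional_eq0// mU leqnn andbT.
by apply/(coord_mxP w mU); apply: trmx_inj; rewrite trmx_mul trmxK wU trmx0.
Qed.

End HyperplaneChart.

(** * Hyperplanes of T_2 Q that are subalgebras *)

Section T2Algebra.
Variables (k : fieldType) (Q : quiver).
Local Notation B := (T2 k Q).
Implicit Types (x y f g : B) (u v s t : vertex Q) (a b : arrow Q).

(* The coordinates of an element of [T2 k Q] have type [k^o]; with the casts to
   [k], the operations on the right-hand sides are those of the field. *)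
Lemma T2_mul_inl x y v : (x * y) (inl v) = (x (inl v) : k) * (y (inl v) : k) :> k.
Proof. by rewrite ffunE. Qed.

Lemma T2_mul_inr x y a :
  (x * y) (inr a) = (x (inl (src a)) : k) * (y (inr a) : k) + (x (inr a) : k) *
    (y (inl (tgt a)) : k) :> k.
Proof. by rewrite ffunE. Qed.

Lemma T2_one_inl v : (1 : B) (inl v) = 1 :> k.
Proof. exact: (T2_oneE k (inl v)). Qed.

Lemma T2_one_inr a : (1 : B) (inr a) = 0 :> k.
Proof. exact: (T2_oneE k (inr a)). Qed.

Lemma e_inl u v : e_ k u (inl v) = (v == u)%:R :> k.
Proof. by rewrite ffunE. Qed.

Lemma e_inr u a : e_ k u (inr a) = 0 :> k.
Proof. by rewrite ffunE. Qed.

Lemma a_inl v b : a_ k b (inl v) = 0 :> k.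
Proof. by rewrite ffunE. Qed.

Lemma a_inr a b : a_ k b (inr a) = (a == b)%:R :> k.
Proof. by rewrite ffunE. Qed.

Lemma T2P x y : (forall v, x (inl v) = y (inl v)) ->
  (forall a, x (inr a) = y (inr a)) -> x = y.
Proof. by move=> xyv xya; apply/ffunP => -[v|a]. Qed.

Lemma T2_addE x y i : (x + y) i = (x i : k) + (y i : k) :> k. Proof. by rewrite
  ffunE. Qed.
Lemma T2_oppE x i : (- x) i = - (x i : k) :> k. Proof. by rewrite ffunE. Qed.
Lemma T2_scaleE c x i : (c *: x) i = c * (x i : k) :> k. Proof. by rewrite ffunE.
  Qed.
Lemma T2_sumE (I : finType) (P : pred I) (F : I -> B) i :
  (\sum_(j | P j) F j) i = \sum_(j | P j) (F j i : k) :> k.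
Proof. by rewrite sum_ffunE. Qed.
Lemma T2_0E i : (0 : B) i = 0 :> k. Proof. by rewrite ffunE. Qed.

Let T2E := (T2_addE, T2_oppE, T2_scaleE, T2_0E, T2_mul_inl, T2_mul_inr, T2_one_inl,
  T2_one_inr, e_inl, e_inr, a_inl, a_inr).

Lemma mul_e_e u v : e_ k u * e_ k v = (u == v)%:R *: e_ k u.
Proof.
apply: T2P => [w|a]; rewrite !T2E ?mulr0 ?mul0r ?addr0//.
by case: (eqVneq w u) => [->|]; rewrite ?mul1r ?mul0r ?mulr0 ?mulr1.
Qed.

Lemma mul_e_a u b : e_ k u * a_ k b = (src b == u)%:R *: a_ k b.
Proof.
apply: T2P => [w|a]; rewrite !T2E ?mulr0 ?mul0r ?addr0//.
by case: (eqVneq a b) => [->|]; rewrite ?mulr1 ?mulr0.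
Qed.

Lemma mul_a_e u b : a_ k b * e_ k u = (tgt b == u)%:R *: a_ k b.
Proof.
apply: T2P => [w|a]; rewrite !T2E ?mulr0 ?mul0r ?add0r//.
by case: (eqVneq a b) => [->|]; rewrite ?mulr1 ?mulr0 ?mul1r ?mul0r.
Qed.

Lemma mul_a_a a b : a_ k a * a_ k b = 0.
Proof. by apply: T2P => [w|c]; rewrite !T2E ?mulr0 ?mul0r ?addr0. Qed.

(** The symmetric form for which the vertices and the arrows are orthonormal; it identifies the
    algebra with its dual. *)
Definition pairing f x : k^o := \sum_i (f i : k) * (x i : k).

Lemma pairing_is_linear f : linear (pairing f).
Proof.
move=> c x y; rewrite /pairing scaler_sumr -big_split; apply: eq_bigr => i _.
by rewrite !T2E mulrDr mulrCA.
Qed.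
HB.instance Definition _ f :=
  GRing.isLinear.Build k B k^o _ (pairing f) (pairing_is_linear f).

Lemma pairing_e f v : pairing f (e_ k v) = f (inl v) :> k.
Proof.
rewrite /pairing (bigD1 (inl v))//= big1 => [|[w|a] ne]; rewrite !T2E ?mulr0//.
  by rewrite eqxx mulr1 addr0.
by rewrite -[w == v]/(inl w == inl v :> _ + arrow Q) (negPf ne) mulr0.
Qed.

Lemma pairing_a f b : pairing f (a_ k b) = f (inr b) :> k.
Proof.
rewrite /pairing (bigD1 (inr b))//= big1 => [|[w|a] ne]; rewrite !T2E ?mulr0//.
  by rewrite eqxx mulr1 addr0.
by rewrite -[a == b]/(inr a == inr b :> vertex Q + _) (negPf ne) mulr0.
Qed.

Lemma pairing_sum f x :
  pairing f x = \sum_v (f (inl v) : k) * (x (inl v) : k) +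
    \sum_a (f (inr a) : k) * (x (inr a) : k) :> k.
Proof.
rewrite [in LHS](T2_decomp x) linearD !linear_sum; congr (_ + _).
  by apply: eq_bigr => v _; rewrite linearZ/= pairing_e mulrC.
by apply: eq_bigr => v _; rewrite linearZ/= pairing_a mulrC.
Qed.

Definition perp f : {vspace B} := lker (linfun (pairing f)).

Lemma memv_perp f x : (x \in perp f) = (pairing f x == 0).
Proof. by rewrite memv_ker lfunE. Qed.

(** The space [W_st] of functionals, represented through [pairing]; for [s = t] only the arrows
    contribute. *)
Definition perp_space s t : {vspace B} :=
  (<[e_ k s - e_ k t]> + arrow_span k s t)%VS.

Lemma memv_arrow_span s t g : g \in arrow_span k s t <->
  (forall v, g (inl v) = 0) /\ (forall a, a \notin arrows s t -> g (inr a) = 0).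
Proof.
split=> [/memv_sumP[h hh ->]|[gv ga]].
  split=> [v|a nst]; rewrite T2_sumE big1// => b bst;
    have /vlineP[c ->] := hh b bst; rewrite !T2E ?mulr0//.
  by rewrite (_ : (a == b) = false) ?mulr0//; apply: contraNF nst => /eqP ->.
rewrite (T2_decomp g) big1 ?add0r => [|v _]; last by rewrite gv scale0r.
rewrite memv_suml// => b _; have [bst|nst] := boolP (b \in arrows s t).
  by apply: subvP (sumv_sup b bst (subvv _)) _ _; rewrite memvZ// memv_line.
by rewrite ga// scale0r mem0v.
Qed.

Lemma memv_perp_space s t f : f \in perp_space s t <->
  (exists l, forall v, f (inl v) = l * ((v == s)%:R - (v == t)%:R)) /\
  (forall a, a \notin arrows s t -> f (inr a) = 0).
Proof.
split=> [/memv_addP[_ /vlineP[l ->] [g /memv_arrow_span[gv ga] ->]]|[[l fv] fa]].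
  split=> [|a nst]; first by exists l => v; rewrite !T2E gv addr0.
  by rewrite !T2E ga// addr0 subr0 mulr0.
rewrite -[f](subrK (l *: (e_ k s - e_ k t))) addrC memv_add ?memvZ ?memv_line//.
apply/memv_arrow_span; split=> [v|a nst]; rewrite !T2E ?fv ?subrr//.
by rewrite fa// mulr0 subr0.
Qed.

Lemma pairing_perp_space s t f l x :
  (forall v, f (inl v) = l * ((v == s)%:R - (v == t)%:R)) ->
  (forall a, a \notin arrows s t -> f (inr a) = 0) ->
  pairing f x = l * ((x (inl s) : k) - (x (inl t) : k)) +
    \sum_(a in arrows s t) (f (inr a) : k) * (x (inr a) : k) :> k.
Proof.
move=> fv fa; rewrite pairing_sum; congr (_ + _).
  have sE u : \sum_v (v == u)%:R * x (inl v) = x (inl u).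
    rewrite (bigD1 u)//= eqxx mul1r big1 ?addr0// => v /negPf ->.
    by rewrite mul0r.
  rewrite -!sE -sumrB mulr_sumr; apply: eq_bigr => v _.
  by rewrite fv -mulrA mulrBl.
rewrite [RHS]big_mkcond; apply: eq_bigr => a _.
by case: ifPn => // nst; rewrite fa ?mul0r.
Qed.

Lemma subalgebra_perp s t f : f \in perp_space s t -> subalgebra (perp f).
Proof.
move=> /memv_perp_space[[l fv] fa].
have pE x := pairing_perp_space x fv fa.
split.
  rewrite memv_perp pE !T2E subrr mulr0 add0r big1// => a _.
  by rewrite !T2E mulr0.
apply/prodvP => x y; rewrite !memv_perp => /eqP px /eqP py.
(* [pairing f] is a derivation twisted by the characters of [s] and [t], so its kernel is closed
   under products. *)
have : pairing f (x * y) = x (inl s) * pairing f y + pairing f x * y (inl t).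
  rewrite !pE !T2E [in RHS]mulrDr [in RHS]mulrDl [in RHS]addrACA mulr_sumr
    mulr_suml -big_split/=.
  congr (_ + _); first by ring.
  apply: eq_bigr => a; rewrite !inE => /andP[/eqP <- /eqP <-].
  by rewrite !T2E; ring.
by rewrite px py mulr0 mul0r addr0 => ->.
Qed.

(** Any two elements produce an element of the kernel; the products of such elements turn the
    subalgebra condition into polynomial identities without side conditions. *)
Lemma pairing_comb f x y : pairing f (pairing f y *: x - pairing f x *: y) = 0.
Proof.
apply/eqP; rewrite linearB subr_eq0 !linearZ/=; apply/eqP; exact: mulrC.
Qed.

(** * Functionals whose kernel is a subalgebra *)

Section Classification.
Variable f : B.
Hypothesis subf : subalgebra (perp f).
Local Notation phi := (pairing f).

Lemma subalgebra_pairing1 : \sum_v f (inl v) = 0.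
Proof.
have [/[!memv_perp]/eqP p1 _] := subf; rewrite -[RHS]p1.
rewrite pairing_sum [X in _ + X]big1 ?addr0 => [|a _];
  last by rewrite T2_one_inr mulr0.
by apply: eq_bigr => v _; rewrite T2_one_inl mulr1.
Qed.

Lemma subalgebra_pairingM x y : phi x = 0 -> phi y = 0 -> phi (x * y) = 0.
Proof.
move=> px py; apply/eqP; rewrite -memv_perp; have [_ /subvP] := subf; apply.
by rewrite memv_mul ?memv_perp ?px ?py.
Qed.

Lemma subalgebra_pairingMr p r q : phi p = 0 -> phi q * phi (p * r) = phi r * phi
  (p * q).
Proof.
move=> pp; apply/eqP; rewrite -subr_eq0; apply/eqP.
rewrite -[RHS](@subalgebra_pairingM p (phi q *: r - phi r *: q))//.
  by rewrite mulrBr -!scalerAr linearB !linearZ.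
exact: pairing_comb.
Qed.

Lemma subalgebra_pairingMl p r q : phi p = 0 -> phi q * phi (r * p) = phi r * phi
  (q * p).
Proof.
move=> pp; apply/eqP; rewrite -subr_eq0; apply/eqP.
rewrite -[RHS](@subalgebra_pairingM (phi q *: r - phi r *: q) p)//.
  by rewrite mulrBl -!scalerAl linearB !linearZ.
exact: pairing_comb.
Qed.

(** The expansion of the product of two kernel elements given by [pairing_comb]. *)
Lemma subalgebra_pairing4 (p q r s : B) :
  phi q * phi s * phi (p * r) - phi q * phi r * phi (p * s) -
  phi p * phi s * phi (q * r) + phi p * phi r * phi (q * s) = 0.
Proof.
rewrite -[RHS](subalgebra_pairingM (pairing_comb f p q) (pairing_comb f r s)).
rewrite mulrBl !mulrBr -!scalerAl -!scalerAr !linearB !linearZ/=.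
by rewrite /GRing.scale/=; ring.
Qed.

Let phiE := (pairing_e, pairing_a, mul_e_e, mul_e_a, mul_a_e, mul_a_a).

(** Only the product [e_u * e_u] survives in the identity. So at most two vertices lie in the
    support of [f]. *)
Lemma subalgebra_vertices u v w : u != v -> u != w -> v != w ->
  f (inl u) * f (inl v) * f (inl w) = 0.
Proof.
move=> uv uw vw; have := subalgebra_pairing4 (e_ k u) (e_ k v) (e_ k u) (e_ k w).
rewrite !mul_e_e !linearZ/= !phiE [v == u]eq_sym (negPf uv) (negPf uw) (negPf vw)
  eqxx.
by rewrite /GRing.scale/= => <-; ring.
Qed.

(** Here [e_w] is in the kernel and [e_w * e_s = 0], so [f] vanishes on [e_w * a]. Thus, once some
    vertex lies in the support of [f], the arrows of the support start at such vertices. *)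
Lemma subalgebra_arrow_src w s a : w != s -> f (inl w) = 0 -> f (inl s) != 0 ->
  f (inr a) != 0 -> src a != w.
Proof.
move=> ws fw fs fa; have := @subalgebra_pairingMr (e_ k w) (a_ k a) (e_ k s).
rewrite !mul_e_e !mul_e_a !linearZ/= !phiE => /(_ fw) /eqP.
rewrite (negPf ws) /GRing.scale/= mul0r mulr0.
by case: (eqVneq (src a) w) => //; rewrite mul1r mulf_eq0 (negPf fs) (negPf fa).
Qed.

Lemma subalgebra_arrow_tgt w s a : w != s -> f (inl w) = 0 -> f (inl s) != 0 ->
  f (inr a) != 0 -> tgt a != w.
Proof.
move=> ws fw fs fa; have := @subalgebra_pairingMl (e_ k w) (a_ k a) (e_ k s).
rewrite !mul_e_e !mul_a_e !linearZ/= !phiE => /(_ fw) /eqP.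
rewrite [s == w]eq_sym (negPf ws) /GRing.scale/= mul0r mulr0.
by case: (eqVneq (tgt a) w) => //; rewrite mul1r mulf_eq0 (negPf fs) (negPf fa).
Qed.

(** The identity reduces to [f_a ^ 2 * f_w = 0]. With two vertices in the support, it excludes the
    loops at either of them. *)
Lemma subalgebra_arrow_loop w a : f (inl w) != 0 -> src a != w -> tgt a != w ->
  f (inr a) = 0.
Proof.
move=> fw sa ta; have := subalgebra_pairing4 (a_ k a) (e_ k w) (a_ k a) (e_ k w).
rewrite mul_e_e mul_e_a mul_a_e mul_a_a linear0 !linearZ/= !phiE (negPf sa)
  (negPf ta) eqxx.
rewrite /GRing.scale/= !(mul0r, mulr0, subr0, add0r, mul1r) => /eqP.
by rewrite !mulf_eq0 (negPf fw) orbF orbb => /eqP.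
Qed.

(** The identity reduces to [f_a * f_b * f_w = 0], which prevents the support from containing arrows
    in both directions between its two vertices. *)
Lemma subalgebra_arrow_opp w a b : f (inl w) != 0 -> tgt a != w -> src b != w ->
  f (inr a) != 0 -> f (inr b) = 0.
Proof.
move=> fw ta sb fa; have := subalgebra_pairing4 (a_ k a) (e_ k w) (a_ k b) (e_ k w).
rewrite mul_e_e mul_e_a mul_a_e mul_a_a linear0 !linearZ/= !phiE (negPf ta)
  (negPf sb) eqxx.
rewrite /GRing.scale/= !(mul0r, mulr0, subr0, add0r, mul1r) => /eqP.
by rewrite !mulf_eq0 (negPf fw) (negPf fa) orbF => /eqP.
Qed.

Lemma subalgebra_perp_space : f != 0 -> exists s t, f \in perp_space s t.
Proof.
move=> f0; have [/existsP[s fs]|] := boolP [exists s, f (inl s) != 0]; last first.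
  (* No vertex is in the support: all the [e_v] lie in the kernel, and multiplying by them shows
     that the arrows of the support are parallel. *)
  rewrite negb_exists => /forallP fv0.
  have {}fv0 v : f (inl v) = 0 by apply/eqP; have := fv0 v; rewrite negbK.
  have [/existsP[a fa]|] := boolP [exists a, f (inr a) != 0]; last first.
    rewrite negb_exists => /forallP fa0; case/eqP: f0; apply: T2P => [v|a].
      by rewrite fv0 T2_0E.
    by rewrite T2_0E; apply/eqP; have := fa0 a; rewrite negbK.
  exists (src a), (tgt a); apply/memv_perp_space; split.
    by exists 0 => v; rewrite fv0 mul0r.
  move=> b; apply: contraNeq => fb; rewrite inE; apply/andP; split.
    have := @subalgebra_pairingMr (e_ k (src b)) (a_ k b) (a_ k a).
    rewrite !mul_e_a !linearZ/= !phiE eqxx => /(_ (fv0 _)) /eqP.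
    rewrite /GRing.scale/= mul1r [src a == _]eq_sym;
      case: (eqVneq (src b) (src a)) => //= _.
    by rewrite mul0r mulr0 mulf_eq0 (negPf fa) (negPf fb).
  have := @subalgebra_pairingMl (e_ k (tgt b)) (a_ k b) (a_ k a).
  rewrite !mul_a_e !linearZ/= !phiE eqxx => /(_ (fv0 _)) /eqP.
  rewrite /GRing.scale/= mul1r [tgt a == _]eq_sym;
    case: (eqVneq (tgt b) (tgt a)) => //= _.
  by rewrite mul0r mulr0 mulf_eq0 (negPf fa) (negPf fb).
(* The vertex coefficients add up to zero, so a second vertex is in the support. *)
have [t ts ft] : exists2 t, t != s & f (inl t) != 0.
  apply/exists_inP; rewrite -[X in is_true X]negbK negb_exists_in; apply: contra fs.
  move=> /forall_inP h; have := subalgebra_pairing1;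
    rewrite (bigD1 s)//= big1 ?addr0.
    by move->.
  by move=> v vs; apply/eqP; rewrite -[_ == _]negbK; apply: h.
have fv v : v != s -> v != t -> f (inl v) = 0.
  move=> vs vt; have := subalgebra_vertices vs vt; rewrite eq_sym => /(_ ts)/eqP.
  by rewrite !mulf_eq0 (negPf fs) (negPf ft) !orbF => /eqP.
have fst : f (inl t) = - f (inl s).
  have := subalgebra_pairing1; rewrite (bigD1 s)// (bigD1 t)//= big1 ?addr0.
    by move/eqP; rewrite addrC addr_eq0 => /eqP.
  by move=> v /andP[vs vt]; apply: fv.
have fvE v : f (inl v) = f (inl s) * ((v == s)%:R - (v == t)%:R).
  have [->|vs] := eqVneq v s; first by rewrite eq_sym (negPf ts) subr0 mulr1.
  have [->|vt] := eqVneq v t; first by rewrite sub0r mulrN1.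
  by rewrite fv// subr0 mulr0.
have fa a : f (inr a) != 0 -> (src a == s) && (tgt a == t) || (src a == t) &&
  (tgt a == s).
  move=> fa0.
  have srcP : (src a == s) || (src a == t).
    apply: contraNT fa0; rewrite negb_or => /andP[as_ at_].
    apply/negPn/negP => fa0; have := subalgebra_arrow_src as_ (fv _ as_ at_) fs fa0.
    by rewrite eqxx.
  have tgtP : (tgt a == s) || (tgt a == t).
    apply: contraNT fa0; rewrite negb_or => /andP[as_ at_].
    apply/negPn/negP => fa0; have := subalgebra_arrow_tgt as_ (fv _ as_ at_) fs fa0.
    by rewrite eqxx.
  case/orP: srcP tgtP => /eqP sa /orP[]/eqP ta; rewrite sa ta !eqxx ?orbT//.
    by case/eqP: fa0; apply: (@subalgebra_arrow_loop t); rewrite ?sa ?ta// eq_sym.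
  by case/eqP: fa0; apply: (@subalgebra_arrow_loop s); rewrite ?sa ?ta.
(* An arrow of the support from [s] to [t] fixes the direction. Otherwise the pair [t], [s] works,
   even if no arrow is in the support. *)
have [/existsP[a /andP[ast fa0]]|] := boolP [exists a, (a \in arrows s t) && (f
  (inr a) != 0)].
  exists s, t; apply/memv_perp_space; split; first by exists (f (inl s)).
  move=> b; apply: contraNeq => fb; have := fa b fb;
    rewrite inE => /orP[//|/andP[sb tb]].
  move: ast; rewrite inE => /andP[/eqP sa /eqP ta]; case/eqP: fb.
  by apply: (@subalgebra_arrow_opp s a) => //; rewrite ?ta// (eqP sb).
rewrite negb_exists => /forallP nst; exists t, s; apply/memv_perp_space; split.
  by exists (- f (inl s)) => v; rewrite fvE mulNr -mulrN opprB.
move=> b; apply: contraNeq => fb; have := fa b fb; rewrite inE => /orP[st|//].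
by have := nst b; rewrite inE st fb.
Qed.

End Classification.

End T2Algebra.

(** * The spaces [W_st] and their sets of hyperplanes *)

Section PerpSpaces.
Variables (k : fieldType) (Q : quiver).
Local Notation B := (T2 k Q).
Implicit Types (s t u v : vertex Q) (f g : B) (W : {vspace B}).

Lemma a_neq0 b : a_ k b != 0 :> B.
Proof.
by apply/eqP => /ffunP/(_ (inr b))/eqP; rewrite a_inr T2_0E eqxx oner_eq0.
Qed.

Lemma e_sub_eq0 s t : (e_ k s - e_ k t == 0 :> B) = (s == t).
Proof.
apply/eqP/eqP => [/ffunP/(_ (inl s))|->]; last exact: subrr.
rewrite T2_addE T2_oppE !e_inl T2_0E eqxx; case: eqVneq => // _ /eqP.
by rewrite subr0 oner_eq0.
Qed.

Lemma dim_arrow_span s t : \dim (arrow_span k s t) = #|arrows s t|.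
Proof.
have /directvP/= -> : directv (\sum_(b in arrows s t) <[a_ k b]>).
  apply/directv_sum_independent => x xb x0 a ast; have /vlineP[c xE] := xb a ast.
  move/ffunP/(_ (inr a)): x0; rewrite T2_sumE T2_0E (bigD1 a)//= big1 ?addr0.
    by rewrite xE T2_scaleE a_inr eqxx mulr1 => ->; rewrite scale0r.
  move=> b /andP[bst ba]; have /vlineP[d ->] := xb b bst.
  by rewrite T2_scaleE a_inr eq_sym (negPf ba) mulr0.
by rewrite -sum1_card; apply: eq_bigr => b _; rewrite dim_vline a_neq0.
Qed.

Lemma dim_perp_space s t : \dim (perp_space k s t) = ((s != t) + #|arrows s t|)%N.
Proof.
rewrite dimv_disjoint_sum ?dim_vline ?dim_arrow_span ?e_sub_eq0//.
apply/eqP; rewrite -subv0; apply/subvP => x /memv_capP[/vlineP[c ->]].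
move=> /memv_arrow_span[/(_ s) + _]; rewrite memv0 scaler_eq0 e_sub_eq0.
rewrite T2_scaleE T2_addE T2_oppE !e_inl eqxx.
case: (s == t); first by rewrite orbT.
by rewrite subr0 mulr1 => ->; rewrite eqxx.
Qed.

(** An arrow in the first space determines both ends. Without arrows, only [e_u - e_v] is left,
    which determines the pair up to order. *)
Lemma perp_space_subset u v s t : (0 < \dim (perp_space k u v))%N ->
  (perp_space k u v <= perp_space k s t)%VS ->
  (u, v) = (s, t) \/ (u, v) = (t, s) /\ arrows u v = finset.set0.
Proof.
rewrite dim_perp_space => duv /subvP sub.
have arr a : a \in arrows u v -> (u, v) = (s, t).
  move=> auv; have /sub/memv_perp_space[_ /(_ a)] : a_ k a \in perp_space k u v.
    apply/memv_perp_space; split; first by exists 0 => w; rewrite a_inl mul0r.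
    by move=> b; rewrite a_inr; apply: contraNeq; case: (eqVneq b a) => [->|];
      rewrite ?eqxx.
  rewrite a_inr eqxx; have [+ _|_ /(_ isT)/eqP] := boolP (a \in arrows s t).
    by move: auv; rewrite !inE => /andP[/eqP -> /eqP ->] /andP[/eqP -> /eqP ->].
  by rewrite oner_eq0.
have [a0|/finset.set0Pn[a /arr]] := eqVneq (arrows u v) finset.set0; last by left.
move: duv; rewrite a0 cards0 addn0 lt0b => uv.
have /sub/memv_perp_space[[l hl] _] : e_ k u - e_ k v \in perp_space k u v.
  by apply: subvP (addvSl _ _) _ (memv_line _).
have nz w : w \in [:: u; v] -> w \in [:: s; t].
  rewrite !inE => wuv; have := hl w; rewrite T2_addE T2_oppE !e_inl.
  apply: contra_eqT; rewrite negb_or => /andP[/negPf -> /negPf ->].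
  rewrite subrr mulr0; case/orP: wuv => /eqP ->.
    by rewrite eqxx (negPf uv) subr0 oner_eq0.
  by rewrite eqxx [v == u]eq_sym (negPf uv) sub0r oppr_eq0 oner_eq0.
have := nz u; have := nz v; rewrite !inE !eqxx orbT => /(_ isT) vst /(_ isT) ust.
move: uv; case/orP: ust => /eqP ->; case/orP: vst => /eqP ->; rewrite ?eqxx//.
  by left.
by right.
Qed.

(** The projective space [P(W)], each functional being replaced by its kernel. *)
Definition perp_image (W : {vspace B}) : set (grassmannian B) :=
  [set U | exists f, [/\ f \in W, f != 0 & U = perp f]].

Lemma dim_T2_gt0 : \dim {:B} = (\dim {:B} - 1).+1.
Proof.
rewrite subn1 prednK// lt0n dimv_eq0; apply/eqP => B0.
by have := memvf (1 : B); rewrite B0 memv0 oner_eq0.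
Qed.

Local Notation n := (\dim {:B}).
Local Notation m := (\dim {:B} - 1)%N.

(** The coordinates of [pairing f] in the basis dual to [vbasis], the parameter of
    [hyperplane_of]. *)
Definition perp_row (f : B) : 'rV[k]_n := \row_i pairing f (vbasis {:B})`_i.

Lemma pairingDl (f g x : B) : pairing (f + g) x = pairing f x + pairing g x.
Proof.
by rewrite /pairing -big_split; apply: eq_bigr => i _; rewrite T2_addE mulrDl.
Qed.

Lemma pairingZl (c : k) (f x : B) : pairing (c *: f) x = c * pairing f x :> k.
Proof.
by rewrite /pairing mulr_sumr; apply: eq_bigr => i _; rewrite T2_scaleE mulrA.
Qed.

Lemma perp_row_is_linear : linear perp_row.
Proof. by move=> c f g; apply/rowP => i; rewrite !mxE pairingDl pairingZl. Qed.
HB.instance Definition _ :=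
  GRing.isLinear.Build k B 'rV[k]_n _ perp_row perp_row_is_linear.

Lemma perp_rowE f : hyperplane_of (perp_row f) = perp f.
Proof.
rewrite /hyperplane_of /perp -[in RHS](functionalK (linfun (pairing f)));
  congr (lker (functional _)).
by apply/rowP => i; rewrite !mxE lfunE.
Qed.

Lemma perp_row_eq0 f : (perp_row f == 0) = (f == 0).
Proof.
apply/eqP/eqP => [f0|->]; last exact: linear0.
have fx x : pairing f x = 0.
  rewrite (coord_vbasis (memvf x)) linear_sum big1// => i _.
  by rewrite linearZ/=; have /rowP/(_ i) := f0; rewrite !mxE => ->; rewrite scaler0.
by apply: T2P => [v|a]; rewrite T2_0E -?pairing_e -?pairing_a fx.
Qed.

Definition perp_mx (W : {vspace B}) : 'M[k]_(\dim W, n) :=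
  \matrix_i perp_row (vbasis W)`_i.

Lemma perp_mxE (W : {vspace B}) (c : 'rV_(\dim W)) :
  c *m perp_mx W = perp_row (\sum_i c 0 i *: (vbasis W)`_i).
Proof.
rewrite mulmx_sum_row linear_sum; apply: eq_bigr => i _.
by rewrite linearZ rowK.
Qed.

Lemma perp_mx_rank (W : {vspace B}) : \rank (perp_mx W) = \dim W.
Proof.
apply/eqP; rewrite -/(row_free _) -kermx_eq0; apply/rowV0P => c /sub_kermxP.
rewrite perp_mxE => /eqP; rewrite perp_row_eq0 => /eqP c0.
have /freeP fr := basis_free (vbasisP W).
by apply/rowP => i; rewrite mxE; apply: fr c0 i.
Qed.

Lemma perp_mx_sub (W : {vspace B}) f : f \in W -> (perp_row f <= perp_mx W)%MS.
Proof.
move=> fW; apply/submxP; exists (\row_i coord (vbasis W) i f).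
rewrite perp_mxE [in LHS](coord_vbasis fW); congr perp_row.
by apply: eq_bigr => i _; rewrite mxE.
Qed.

Lemma perp_imageE (W : {vspace B}) :
  perp_image W = sub_image (@hyperplane_of k B) (perp_mx W).
Proof.
apply/seteqP; split=> [_ [f [fW f0 ->]]|_ [v [v0 /submxP[c vE] ->]]].
  by exists (perp_row f); rewrite perp_row_eq0 perp_mx_sub// perp_rowE.
move: v0; rewrite {}vE perp_mxE perp_row_eq0 => v0.
exists (\sum_i c 0 i *: (vbasis W)`_i); rewrite perp_rowE; split=> //.
by apply: memv_suml => i _; rewrite memvZ// vbasis_mem// mem_nth// size_tuple.
Qed.

Lemma Gr_perp (U : {vspace B}) : Gr m U -> exists2 f, f != 0 & U = perp f.
Proof.
move=> /(hyperplane_chart_onto (dim_T2_gt0))[w w0 <-].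
have : (w <= perp_mx (fullv : {vspace B}))%MS.
  by rewrite submx_full// /row_full perp_mx_rank.
move=> /submxP[c wE]; move: w0; rewrite {}wE perp_mxE /= perp_row_eq0 perp_rowE.
by exists (\sum_i c 0 i *: (vbasis {:B})`_i).
Qed.

End PerpSpaces.

(** * Topology of the sets [P(W)] and the decomposition of msa(Q) *)

Section PerpTopology.
Variables (k : closedFieldType) (Q : quiver).
Local Notation B := (T2 k Q).
Local Notation m := (\dim {:B} - 1)%N.
Implicit Types W : {vspace B}.

Let chart_ex := hyperplane_chart (dim_T2_gt0 k Q).
Let onto := hyperplane_chart_onto (dim_T2_gt0 k Q).

Lemma closed_perp_image W : closed (perp_image W).
Proof. by have [L [G hLG]] := chart_ex; rewrite perp_imageE;
  exact: (@closed_sub_image _ _ _ _ _ _ _ hLG onto). Qed.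

Lemma perp_mx_neq0 W : (perp_mx W != 0) = (0 < \dim W)%N.
Proof. by rewrite -mxrank_eq0 perp_mx_rank lt0n. Qed.

Lemma irreducible_perp_image W : (0 < \dim W)%N -> irreducible (perp_image W).
Proof.
have [L [G hLG]] := chart_ex; rewrite perp_imageE => W0.
by apply: sub_image_irreducible hLG _ _ _; rewrite perp_mx_neq0.
Qed.

Lemma dimension_perp_image W d : \dim W = d.+1 -> dimension (perp_image W) d.
Proof.
have [L [G hLG]] := chart_ex; rewrite perp_imageE => W0.
by apply: sub_image_dimension hLG onto _ _ _ _; rewrite perp_mx_rank.
Qed.

Lemma projective_perp_image W : (0 < \dim W)%N -> is_projective_space m
  (perp_image W).
Proof.
have [L [G hLG]] := chart_ex; rewrite perp_imageE => W0.
by apply: sub_image_projective hLG _ _ _; rewrite perp_mx_neq0.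
Qed.

Lemma perp_image_subset W W' : perp_image W `<=` perp_image W' -> (W <= W')%VS.
Proof.
have [L [G hLG]] := chart_ex; rewrite !perp_imageE.
move=> /(sub_image_subset hLG) sub; apply/subvP => f /perp_mx_sub fW.
have /submxP[c] := submx_trans fW sub; rewrite perp_mxE => /eqP.
rewrite -subr_eq0 -linearB perp_row_eq0 subr_eq0 => /eqP ->.
by apply: memv_suml => i _; rewrite memvZ// vbasis_mem// mem_nth// size_tuple.
Qed.

Lemma perp_image_Gr W : perp_image W `<=` Gr m.
Proof.
have [L [G hLG]] := chart_ex; rewrite !perp_imageE => _ [v [v0 _ ->]].
exact: (chart_Gr hLG).
Qed.

Lemma msa_perp_image (U : grassmannian B) : msa k Q U <->
  exists s t, perp_image (perp_space k s t) U.
Proof.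
split=> [[/Gr_perp[f f0 ->] /subalgebra_perp_space/(_ f0)[s [t fst]]]|[s [t st]]].
  by exists s, t, f.
split; first exact: perp_image_Gr st.
by case: st => f [fst _ ->]; apply: subalgebra_perp fst.
Qed.

End PerpTopology.

(** * The radical and the inner orbits *)

Section Radical.
Variables (k : fieldType) (Q : quiver).
Local Notation B := (T2 k Q).
Implicit Types (x y f g : B) (s t u v w : vertex Q).

Lemma pairing_el v x : pairing (e_ k v) x = x (inl v) :> k.
Proof.
by rewrite -(pairing_e x v) /pairing; apply: eq_bigr => i _; rewrite mulrC.
Qed.

Lemma pairing_e_sub s t x :
  pairing (e_ k s - e_ k t) x = (x (inl s) : k) - (x (inl t) : k) :> k.
Proof. by rewrite pairingDl -scaleN1r pairingZl !pairing_el mulN1r. Qed.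

Lemma memv_perp_e v x : (x \in perp (e_ k v)) = (x (inl v) == 0 :> k).
Proof. by rewrite memv_perp -(pairing_el v x). Qed.

(** This is the kernel of the character [x_v], a left ideal of codimension one. *)
Lemma maximal_left_ideal_perp_e v : maximal_left_ideal (perp (e_ k v)).
Proof.
split.
- apply/prodvP => x y _; rewrite !memv_perp_e T2_mul_inl => /eqP ->.
  by rewrite mulr0.
- apply/eqP => full; have := memvf (1 : B).
  by rewrite -full memv_perp_e T2_one_inl oner_eq0.
move=> I' _ sub; have [->|neq] := eqVneq I' (perp (e_ k v)); [by left | right].
have /subvPn[y yI'] : ~~ (I' <= perp (e_ k v))%VS.
  by apply: contra neq => sub'; rewrite eqEsubv sub' sub.
rewrite memv_perp_e => yv; apply/vspaceP => x; rewrite memvf.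
rewrite -[x](subrK ((x (inl v) / y (inl v)) *: y)) memvD ?memvZ//.
apply: (subvP sub); rewrite memv_perp_e T2_addE T2_oppE T2_scaleE divfK//.
by rewrite subrr.
Qed.

Lemma T2_mul_rad x y : (forall v, x (inl v) = 0) -> (forall v, y (inl v) = 0) ->
  x * y = 0.
Proof.
move=> x0 y0; apply: T2P => [v|a]; rewrite T2_0E ?T2_mul_inl ?T2_mul_inr !x0 ?y0.
  by rewrite mulr0.
by rewrite mul0r mulr0 addr0.
Qed.

Lemma T2_rad_inv x : (forall v, x (inl v) = 0) -> (1 + x) * (1 - x) = 1.
Proof.
by move=> x0; rewrite mulrDl mulrBr mulr1 mul1r mulrBr mulr1 T2_mul_rad// subr0
  subrK.
Qed.

Lemma memv_jacobson x : x \in jacobson B <-> forall v, x (inl v) = 0.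
Proof.
split=> [/memv_bigcap xJ v|x0].
  by apply/eqP; rewrite -memv_perp_e; apply: xJ; apply: maximal_left_ideal_perp_e.
apply/memv_bigcap => I [/prodvP lI nI maxI]; apply: contrapT => xI.
pose I' := (I + fullv * <[x]>)%VS.
have lI' : left_ideal I'.
  apply/prodvP => y _ _ /memv_addP[i iI [z zx ->]]; rewrite mulrDr memv_add//.
    by apply: lI => //; apply: memvf.
  have : y * z \in (fullv * (fullv * <[x]>))%VS by rewrite memv_mul ?memvf.
  by apply/subvP; rewrite prodvA prodvSl// subvf.
have xI' : x \in I'.
  apply: subvP (addvSr _ _) _ _.
  by have := memv_mul (memvf (1 : B)) (memv_line x); rewrite mul1r.
have [eI'|eI'] := maxI _ lI' (addvSl _ _); first by apply: xI; rewrite -eI'.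
have /memv_addP[i iI [z zx oneE]] : 1 \in I' by rewrite eI' memvf.
have z0 v : z (inl v) = 0.
  apply/eqP; rewrite -memv_perp_e; move: zx;
    apply/subvP/prodvP => y _ _ /vlineP[c ->].
  by rewrite memv_perp_e T2_mul_inl T2_scaleE x0 !mulr0.
(* As [z] squares to zero, [1 + z] is a left inverse of [i = 1 - z], so the left ideal contains
   1. *)
have oneI : 1 \in I.
  have -> : 1 = (1 + z) * i.
    by rewrite -(addrK z i) -oneE T2_rad_inv.
  by apply: lI => //; apply: memvf.
by apply: xI; rewrite -[x]mulr1; apply: lI => //; apply: memvf.
Qed.

Lemma A_sum_perp s t : s != t -> A_sum k s t = perp (e_ k s - e_ k t).
Proof.
move=> st; have pE x : (x \in perp (e_ k s - e_ k t)) = (x (inl s) == x (inl t)).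
  by rewrite memv_perp pairing_e_sub; apply: subr_eq0.
apply/vspaceP => x; apply/idP/idP; last first.
  rewrite pE => /eqP xst.
  (* The vertex part of [x], in which [e_s] and [e_t] share a coefficient; the remainder is in the
     radical. *)
  pose c := x (inl s) *: (e_ k s + e_ k t) +
    \sum_(w | (w != s) && (w != t)) x (inl w) *: e_ k w.
  rewrite -[x](subrK c) addrC memv_add//.
    rewrite memv_add ?memvZ ?memv_line//; apply: memv_sumr => w _.
    by rewrite memvZ// memv_line.
  apply/memv_jacobson => v;
    rewrite T2_addE T2_oppE !T2_addE T2_scaleE T2_addE T2_sumE !e_inl.
  have [->|vs] := eqVneq v s.
    rewrite (negPf st) mulr0n addr0 mulr1 big1 ?addr0 ?subrr// => w /andP[ws _].
    by rewrite T2_scaleE e_inl eq_sym (negPf ws) mulr0.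
  have [->|vt] := eqVneq v t.
    rewrite mulr0n add0r mulr1 big1 ?addr0 ?xst ?subrr// => w /andP[_ wt].
    by rewrite T2_scaleE e_inl eq_sym (negPf wt) mulr0.
  rewrite !mulr0n addr0 mulr0 add0r (bigD1 v) ?vs//= T2_scaleE e_inl eqxx mulr1
    big1 ?addr0 ?subrr//.
  by move=> w /andP[_ wv]; rewrite T2_scaleE e_inl eq_sym (negPf wv) mulr0.
apply/subvP; rewrite !subv_add -memvE; apply/andP; split; first (apply/andP; split).
- by rewrite pE !T2_addE !e_inl !eqxx [t == s]eq_sym (negPf st) mulr0n addr0 add0r.
- apply/subv_sumP => w /andP[ws wt].
  by rewrite -memvE pE !e_inl [s == w]eq_sym (negPf ws) [t == w]eq_sym (negPf wt).
- by apply/subvP => y /memv_jacobson y0; rewrite pE !y0.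
Qed.

(** Only the arrows from [s] to [t] enter into [pairing f], so all the other basis elements lie in
    its kernel. *)
Lemma A_hyp_perp s t f : f \in arrow_span k s t ->
  A_hyp s t (arrow_span k s t :&: perp f) = perp f.
Proof.
move=> /memv_arrow_span[fv fa]; apply/vspaceP => x; apply/idP/idP; last first.
  rewrite memv_perp pairing_sum big1 ?add0r => [|v _]; last by rewrite fv mul0r.
  rewrite (bigID (mem (arrows s t)))/= [X in _ + X]big1 ?addr0 => [/eqP fx|a
    nst]; last first.
    by rewrite fa// mul0r.
  rewrite (T2_decomp x) (bigID (mem (arrows s t)) predT)/= addrA.
  apply: subvP (addvSl _ _) _ _; apply: memv_add; [apply: memv_add|].
  - by apply: memv_sumr => w _; rewrite memvZ// memv_line.
  - rewrite memv_cap; apply/andP; split.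
      by apply: memv_sumr => w _; rewrite memvZ// memv_line.
    rewrite memv_perp linear_sum -[X in _ == X]fx; apply/eqP.
    by apply: eq_bigr => a _; rewrite linearZ/= pairing_a; exact: mulrC.
  - apply: memv_suml => a nst; rewrite memvZ//.
    have ne : (src a, tgt a) != (s, t) by apply: contra nst => /eqP[<- <-];
      rewrite inE !eqxx.
    apply: subvP (sumv_sup (src a, tgt a) ne (subvv _)) _ _ => /=.
    apply/memv_arrow_span; split=> [v|b]; rewrite ?a_inl ?a_inr//.
    by case: (eqVneq b a) => [->|//]; rewrite inE !eqxx.
apply/subvP; rewrite !subv_add; apply/andP; split; first (apply/andP; split;
  first (apply/andP; split)).
- by apply/subv_sumP => w _; rewrite -memvE memv_perp pairing_e fv.
- exact: capvSr.
- apply/subv_sumP => -[u v] ne; apply/subv_sumP => a;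
  rewrite inE/= => /andP[/eqP sa /eqP ta].
  rewrite -memvE memv_perp pairing_a fa//; apply: contra ne.
  by rewrite inE sa ta => /andP[/eqP -> /eqP ->].
- apply/prodvP => y z /memv_jacobson y0 /memv_jacobson z0.
  by rewrite T2_mul_rad// mem0v.
Qed.

Lemma perpZ c f : c != 0 -> perp (c *: f) = perp f.
Proof.
move=> c0; apply/vspaceP => x; rewrite !memv_perp pairingZl.
by rewrite mulf_eq0 (negPf c0).
Qed.

Lemma iotaE x y : (forall v, x (inl v) = 0) -> iota_ (1 + x) y = (1 + x) * y * (1
  - x).
Proof.
move=> x0; have inv := T2_rad_inv x0.
have inv' : (1 - x) * (1 + x) = 1.
  have := @T2_rad_inv (- x); rewrite opprK; apply=> v.
  by rewrite T2_oppE x0 oppr0.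
have uE : (1 + x)^-1 = 1 - x.
  have U : 1 + x \is a GRing.unit by apply/unitrP; exists (1 - x).
  by apply: (mulrI U); rewrite divrr.
have lin : linear (fun y => (1 + x) * y * (1 + x)^-1).
  by move=> c y1 y2; rewrite mulrDr mulrDl -scalerAr -scalerAl.
pose h : {linear B -> B} :=
  HB.pack (fun y => (1 + x) * y * (1 + x)^-1) (GRing.isLinear.Build _ _ _ _ _ lin).
by rewrite /iota_ (lfunE h) /h/= uE.
Qed.

Lemma iota_perp s t f x : f \in arrow_span k s t -> (forall v, x (inl v) = 0) ->
  (iota_ (1 + x) @: perp f)%VS = perp (f + pairing f x *: (e_ k s - e_ k t)).
Proof.
move=> /memv_arrow_span[fv fa] x0.
(* Conjugation by [1 + y] changes the coordinate of an arrow from [s] to [t] by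
   [- y_a * (z_s - z_t)] and fixes those of the vertices. *)
have conj_pairing y z : (forall v, y (inl v) = 0) ->
    pairing f ((1 + y) * z * (1 - y)) =
    pairing f z - pairing f y * ((z (inl s) : k) - (z (inl t) : k)) :> k.
  move=> y0; have pE (w : B) := @pairing_perp_space k Q s t f 0 w
    (fun v => etrans (fv v) (esym (mul0r _))) fa.
  rewrite !pE !mul0r !add0r mulr_suml -sumrB; apply: eq_bigr => a.
  rewrite inE => /andP[/eqP sa /eqP ta].
  rewrite !(T2_mul_inr, T2_mul_inl, T2_addE, T2_oppE, T2_one_inl, T2_one_inr, y0)
    sa ta.
  by ring.
apply/vspaceP => z.
have conj y : (1 + x) * ((1 - x) * y * (1 + x)) * (1 - x) = y.
  by rewrite !mulrA T2_rad_inv// mul1r -mulrA T2_rad_inv// mulr1.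
have mem y : (pairing f y == 0) =
    ((1 + x) * y * (1 - x) \in perp (f + pairing f x *: (e_ k s - e_ k t))).
  rewrite memv_perp; congr (_ == 0);
    rewrite pairingDl pairingZl pairing_e_sub conj_pairing//.
  rewrite !(T2_mul_inl, T2_addE, T2_oppE, T2_one_inl, x0) oppr0 addr0 !mulr1 !mul1r.
  by rewrite subrK.
apply/memv_imgP/idP => [[y yf ->]|zf].
  by rewrite iotaE// -mem -memv_perp.
exists ((1 - x) * z * (1 + x)); last by rewrite iotaE// conj.
by rewrite memv_perp mem conj.
Qed.

Lemma arrow_span_pairing s t f : f \in arrow_span k s t -> f != 0 ->
  exists2 a, a \in arrows s t & f (inr a) != 0.
Proof.
move=> /memv_arrow_span[fv fa] f0; apply/exists_inP; apply: contra_neqT f0.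
rewrite negb_exists_in => /forall_inP f0; apply: T2P => [v|a]; rewrite T2_0E//.
by have [/f0|/fa//] := boolP (a \in arrows s t); rewrite negbK => /eqP.
Qed.

(** Adding a complement of the arrow span to [U] gives a hyperplane of the algebra, the kernel of
    some [f0]; then only the coordinates of [f0] on the arrows from [s] to [t] are kept. *)
Lemma hyperplaneP s t (U : {vspace B}) : hyperplane (arrow_span k s t) U <->
  exists f, [/\ f \in arrow_span k s t, f != 0 & U = (arrow_span k s t :&: perp
    f)%VS].
Proof.
set W := arrow_span k s t.
have dimW f : f \in W -> f != 0 -> (\dim (W :&: perp f)).+1 = \dim W.
  move=> fW f0; rewrite -(limg_ker_dim (linfun (pairing f)) W) -addn1; congr addn.
  apply/esym/eqP; rewrite eqn_leq; apply/andP; split.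
    by apply: leq_trans (dimvS (subvf _)) _; rewrite dimvf.
  have [a ast fa] := arrow_span_pairing fW f0.
  rewrite lt0n dimv_eq0; apply: contraNneq fa => img0.
  have aW : a_ k a \in W by apply: subvP (sumv_sup a ast (subvv _)) _ (memv_line _).
  have := memv_img (linfun (pairing f)) aW.
  by rewrite img0 memv0 lfunE/= pairing_a.
split=> [[UW dU]|[f [fW f0 ->]]]; last by split; [exact: capvSl | exact: dimW].
have dimC : \dim W^C = (\dim {:B} - \dim W)%N by rewrite dimv_compl dimvf.
have capU : (U :&: W^C = 0)%VS.
  by apply/eqP; rewrite -subv0 -(capv_compl W) capvS.
have [|f0 f00 fE] := @Gr_perp k Q (U + W^C)%VS.
  by rewrite /Gr/= dimv_disjoint_sum//; have := dimvS (subvf W);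
    rewrite dimC -dU; lia.
pose f : B := \sum_(a in arrows s t) (f0 (inr a) : k) *: a_ k a.
have fW : f \in W by apply: memv_sumr => a _; rewrite memvZ// memv_line.
have ff0 x : x \in W -> pairing f x = pairing f0 x.
  move=> /memv_arrow_span[xv xa]; rewrite !pairing_sum; congr (_ + _).
    by apply: eq_bigr => v _; rewrite xv !mulr0.
  apply: eq_bigr => a _; have [ast|/xa ->] := boolP (a \in arrows s t);
    last by rewrite !mulr0.
  congr (_ * _); rewrite T2_sumE (bigD1 a)//= big1 ?addr0 => [|b /andP[_ ba]].
    by rewrite T2_scaleE a_inr eqxx mulr1.
  by rewrite T2_scaleE a_inr eq_sym (negPf ba) mulr0.
have fn0 : f != 0.
  apply/eqP => f_0; have WU : (W <= U + W^C)%VS.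
    apply/subvP => x xW; rewrite fE memv_perp -ff0// f_0.
    by rewrite /pairing big1// => i _; rewrite T2_0E mul0r.
  have /dimvS : (W + W^C <= U + W^C)%VS by rewrite subv_add WU addvSr.
  rewrite addv_complf.
  by rewrite dimv_disjoint_sum//; have := dimvS (subvf W); rewrite dimC -dU; lia.
exists f; split=> //; apply/eqP;
  rewrite eqEdim -ltnS dU dimW// leqnn andbT subv_cap UW.
apply/subvP => x xU; have xW := subvP UW x xU.
rewrite memv_perp (ff0 x xW) -memv_perp -fE.
exact: subvP (addvSl _ _) _ xU.
Qed.

Lemma hyp_orbits_perp s t U : hyp_orbits k s t U <->
  exists f c, [/\ f \in arrow_span k s t, f != 0 &
    U = perp (f + c *: (e_ k s - e_ k t))].
Proof.
split=> [[_ /hyperplaneP[f [fW f0 ->]] [x /memv_jacobson x0 ->]]|[f [c [fW f0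
  ->]]]].
  by exists f, (pairing f x); rewrite A_hyp_perp// (iota_perp fW x0).
exists (arrow_span k s t :&: perp f)%VS; first by apply/hyperplaneP; exists f.
have [a ast fa] := arrow_span_pairing fW f0.
(* A radical element with [pairing f x = c], so every [c] is reached by conjugation. *)
pose x := (c / f (inr a)) *: a_ k a.
have x0 v : x (inl v) = 0 :> k by rewrite T2_scaleE a_inl mulr0.
exists x; first exact/memv_jacobson.
by rewrite A_hyp_perp// (iota_perp fW x0) linearZ/= pairing_a /GRing.scale/= divfK.
Qed.

Lemma perp_image_loop s : perp_image (perp_space k s s) = hyp_orbits k s s.
Proof.
have -> : perp_space k s s = arrow_span k s s.
  by rewrite /perp_space subrr; apply/eqP;
    rewrite eqEsubv subv_add addvSr sub0v subvv.
apply/seteqP; split=> [U [f [fW f0 ->]]|U /hyp_orbits_perp[f [c [fW f0 ->]]]].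
  by apply/hyp_orbits_perp; exists f, 0; rewrite scale0r addr0.
by exists f; rewrite subrr scaler0 addr0.
Qed.

(** A functional in [W_st] is [c *: (e_s - e_t)] plus an arrow part: a nonzero arrow part gives a
    point of the orbits, a zero one gives [A(s+t)]. *)
Lemma perp_image_noloop s t : s != t ->
  perp_image (perp_space k s t) = hyp_orbits k s t `|` [set A_sum k s t].
Proof.
move=> st; rewrite A_sum_perp//; apply/seteqP; split=> U.
  move=> [_ [/memv_addP[_ /vlineP[c ->] [f fW ->]] g0 ->]].
  have [f0|f0] := eqVneq f 0.
    right=> /=; move: g0; rewrite f0 addr0 scaler_eq0 => /norP[c0 _].
    by rewrite perpZ.
  by left; apply/hyp_orbits_perp; exists f, c; rewrite addrC.
case=> [/hyp_orbits_perp[f [c [fW f0 ->]]]|->].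
  exists (f + c *: (e_ k s - e_ k t)); split=> //.
    by rewrite addrC memv_add// memvZ// memv_line.
  have [a ast fa] := arrow_span_pairing fW f0.
  apply: contraNneq fa => /ffunP/(_ (inr a)).
  by rewrite !(T2_addE, T2_scaleE, T2_oppE, e_inr) T2_0E subr0 mulr0 addr0 => ->.
exists (e_ k s - e_ k t); split=> //; last by rewrite e_sub_eq0.
by apply: subvP (addvSl _ _) _ (memv_line _).
Qed.

End Radical.

(** * The irreducible components *)

Section Irreducible.
Variable T : topologicalType.

Lemma closed_in_closed (X Z : set T) : closed X -> closed_in X Z -> closed Z.
Proof. by move=> cX [F cF ->]; apply: closedI. Qed.

Lemma closed_bigcup_seq (I : eqType) (s : seq I) (F : I -> set T) :
  (forall i, closed (F i)) -> closed [set x | exists2 i, i \in s & F i x].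
Proof.
move=> cF; elim: s => [|i s IHs].
  rewrite (_ : mkset _ = set0); first exact: closed0.
  by apply/seteqP; split=> x // [].
rewrite (_ : mkset _ = F i `|` [set x | exists2 i, i \in s & F i x]).
  exact: closedU.
apply/seteqP; split=> x [].
- by move=> j; rewrite inE => /orP[/eqP ->|js Fj]; [left | right; exists j].
- by move=> Fx; exists i; rewrite ?mem_head.
- by case=> j js Fj; exists j; rewrite // inE js orbT.
Qed.

Lemma irreducible_bigcup (I : finType) (F : I -> set T) Z :
  (forall i, closed (F i)) -> irreducible Z ->
  (forall x, Z x -> exists i, F i x) -> exists i, Z `<=` F i.
Proof.
move=> cF [[x0 Zx0] irrZ] ZF.
suff H (s : seq I) : Z `<=` [set x | exists2 i, i \in s & F i x] ->
    exists i, Z `<=` F i.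
  by apply: (H (enum I)) => x /ZF[i Fi]; exists i; rewrite // mem_enum.
elim: s => [/(_ x0 Zx0)[]//|i s IHs sub].
have [||//|//] := irrZ (F i) [set x | exists2 i, i \in s & F i x] (cF i).
- exact: closed_bigcup_seq.
- move=> x /sub[j]; rewrite inE => /orP[/eqP ->|js Fj]; first by left.
  by right; exists j.
- by exists i.
Qed.

End Irreducible.

Section Components.
Variables (k : closedFieldType) (Q : quiver).
Local Notation B := (T2 k Q).
Local Notation W := (perp_space k).
Local Notation L s t := (perp_image (perp_space k s t)).
Implicit Types (s t u v : vertex Q).

(** The pairs with [W_st] nonzero and maximal. For [s != t] without arrows from [s] to [t], an arrow
    back would make [W_st] a proper subspace of [W_ts]. *)
Definition component_index s t :=
  s != t /\ arrows s t :|: arrows t s = finset.set0 \/ (s, t) \in V2 Q.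

Lemma component_index_dim s t : component_index s t -> (0 < \dim (W s t))%N.
Proof.
rewrite dim_perp_space; case=> [[-> _]//|]; rewrite inE /= => st.
by rewrite addn_gt0 card_gt0 st orbT.
Qed.

Lemma perp_space_opp s t : arrows s t = finset.set0 -> (W s t <= W t s)%VS.
Proof.
move=> st0; rewrite subv_add; apply/andP; split.
  rewrite -memvE -opprB memvN.
  by apply: subvP (addvSl _ _) _ (memv_line _).
by rewrite /arrow_span st0 big_set0 sub0v.
Qed.

Lemma component_index_ex u v U : L u v U ->
  exists s t, component_index s t /\ (W u v <= W s t)%VS.
Proof.
move=> [f [fW f0 _]]; have : (0 < \dim (W u v))%N.
  by rewrite lt0n dimv_eq0; apply: contraNneq f0 => W0; rewrite -memv0 -W0.
rewrite dim_perp_space; have [uv0|uv _] := eqVneq (arrows u v) finset.set0;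
  last first.
  by exists u, v; split=> //; right; rewrite inE.
rewrite uv0 cards0 addn0 lt0b => uv.
have [vu0|vu] := eqVneq (arrows v u) finset.set0.
  by exists u, v; split=> //; left; rewrite uv0 vu0 finset.setU0.
exists v, u; split; last exact: perp_space_opp.
by right; rewrite inE.
Qed.

Lemma perp_image_mono s t u v : (W s t <= W u v)%VS -> L s t `<=` L u v.
Proof. by move=> /subvP sub U [f [fW f0 ->]]; exists f; rewrite sub. Qed.

Lemma irreducible_sub_component Z : Z `<=` msa k Q -> irreducible Z ->
  exists s t, component_index s t /\ Z `<=` L s t.
Proof.
move=> Zmsa irrZ.
have [|/=|[u v]/= Zuv] := @irreducible_bigcup _ _
    (fun p : vertex Q * vertex Q => L p.1 p.2) Z _ irrZ.
- by move=> p; apply: closed_perp_image.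
- by move=> U /Zmsa/msa_perp_image[s [t st]]; exists (s, t).
have [[U /Zuv Uuv] _] := irrZ.
have [s [t [st sub]]] := component_index_ex Uuv; exists s, t; split=> //.
by move=> U' /Zuv; apply: perp_image_mono.
Qed.

Lemma perp_image_msa s t : L s t `<=` msa k Q.
Proof. by move=> U LU; apply/msa_perp_image; exists s, t. Qed.

(** A larger irreducible set lies in some [P(W_uv)]. The inclusion of [W_st] in [W_uv] forces the
    pairs to agree up to order, and for the reversed pair the absence of arrows makes the two spaces
    equal. *)
Lemma component_perp_image s t : component_index s t ->
  irreducible_component (msa k Q) (L s t).
Proof.
move=> st; have d0 := component_index_dim st; split.
- exact: perp_image_msa.
- exact: irreducible_perp_image.
move=> Z' Z'msa irrZ' sub;
  have [u [v [uv Zuv]]] := irreducible_sub_component Z'msa irrZ'.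
apply/seteqP; split=> // U /Zuv.
have Wsub : (W s t <= W u v)%VS by apply: perp_image_subset => U' /sub; apply: Zuv.
have [[<- <-]//|[[suv tvu] st0]] := perp_space_subset d0 Wsub.
rewrite -suv -tvu; apply: perp_image_mono; apply: perp_space_opp.
case: st => [[_ /eqP]|]; last by rewrite inE/= st0 eqxx.
by rewrite finset.setU_eq0 => /andP[_ /eqP].
Qed.

Lemma component_ex Z : irreducible_component (msa k Q) Z ->
  exists s t, component_index s t /\ Z = L s t.
Proof.
move=> [Zmsa irrZ maxZ];
  have [s [t [st Zst]]] := irreducible_sub_component Zmsa irrZ.
exists s, t; split=> //; apply/esym/maxZ => //; first exact: perp_image_msa.
exact/irreducible_perp_image/component_index_dim.
Qed.

(** The zero space has no hyperplane, so the orbits contribute nothing. *)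
Lemma perp_image_isolated s t : s != t -> arrows s t = finset.set0 ->
  L s t = [set A_sum k s t].
Proof.
move=> st st0; rewrite perp_image_noloop//; apply/seteqP;
  split=> [U [[U' [_]]|//]|U]; last by right.
by rewrite dim_arrow_span st0 cards0.
Qed.

Lemma component_dimensionsP d : component_dimensions Q d <->
  exists s t, component_index s t /\ \dim (W s t) = d.+1.
Proof.
split=> [[[s [t [st st0 ->]]]|[[s [t [st neq ->]]]|[s [ss ->]]]]|[s [t [[[st
  st0]|st]]]]].
- exists s, t; split; first by left.
  have /andP[/eqP s0 _] : (arrows s t == finset.set0) && (arrows t s ==
    finset.set0).
    by rewrite -finset.setU_eq0 st0.
  by rewrite dim_perp_space st s0 cards0.
- by exists s, t; split; [right | rewrite dim_perp_space neq add1n].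
- exists s, s; split; first by right.
  rewrite dim_perp_space eqxx; move: ss; rewrite inE/= -card_gt0.
  by case: #|_| => // n _; rewrite subn1.
- have /andP[/eqP s0 _] : (arrows s t == finset.set0) && (arrows t s ==
  finset.set0).
    by rewrite -finset.setU_eq0 st0.
  by rewrite dim_perp_space st s0 cards0 => -[<-]; left; exists s, t.
rewrite dim_perp_space; case: (eqVneq s t) st => [<-|neq] st dE; right.
  by right; exists s; split=> //; move: dE; rewrite add0n => ->; rewrite subn1.
by left; exists s, t; split=> //; case: dE.
Qed.

Lemma closed_msa : closed (msa k Q).
Proof.
rewrite (_ : msa k Q = [set U | exists2 p, p \in enum {: vertex Q * vertex Q} & L
  p.1 p.2 U]).
  by apply: closed_bigcup_seq => p; apply: closed_perp_image.
apply/seteqP; split=> [U /msa_perp_image[s [t st]]|U [p _ pU]].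
  by exists (s, t); rewrite // mem_enum.
by apply/msa_perp_image; exists p.1, p.2.
Qed.

(** The top of a chain is irreducible, hence the whole chain lies in a single component. *)
Lemma msa_has_chain e : has_chain (msa k Q) e <->
  exists2 d, component_dimensions Q d & (e <= d)%N.
Proof.
split=> [[Z [Zcirr ltZ]]|[d /component_dimensionsP[s [t [st dW]]] led]].
  have [[F _ Ze] irrZe] := Zcirr e (leqnn e).
  have [|s [t [st Zst]]] := irreducible_sub_component _ irrZe.
    by rewrite Ze => U [].
  exists (\dim (W s t)).-1.
    by apply/component_dimensionsP; exists s, t;
      rewrite prednK// component_index_dim.
  have [|_] := @dimension_perp_image k Q (W s t) (\dim (W s t)).-1.
    by rewrite prednK// component_index_dim.
  apply; exists Z; split=> // i lei.
  have [cZ irrZ] := Zcirr i lei; split=> //; exists (Z i).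
    by apply: closed_in_closed cZ; apply: closed_msa.
  apply/esym/setIidPr => U ZiU; apply: Zst.
  have : forall j, (j + i <= e)%N -> Z (j + i)%N U.
    elim=> // j IHj lej; have [sub _] := ltZ (j + i)%N lej.
    by apply: sub; apply: IHj; apply: ltnW.
  by move/(_ (e - i)%N); rewrite subnK//; apply.
have [[Z [Zcirr ltZ]] _] := dimension_perp_image dW.
exists Z; split=> i lei; last by apply: ltZ; apply: leq_trans led.
have [[F cF ZF] irrZ] := Zcirr i (leq_trans lei led); split=> //.
exists (Z i); first by rewrite ZF; apply: closedI => //; apply: closed_perp_image.
by apply/esym/setIidPr => U; rewrite ZF => -[/perp_image_msa].
Qed.

(** For one vertex without arrows msa(Q) is empty, and neither side holds for any [d]. *)
Lemma msa_dimension d : dimension (msa k Q) d <-> is_max (component_dimensions Q) d.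
Proof.
split=> [[/msa_has_chain[d' Cd' led] maxd]|[Cd maxd]].
  have dd' : d' = d.
    apply/eqP; rewrite eqn_leq led andbT; apply: maxd.
    by apply/msa_has_chain; exists d'.
  rewrite -dd'; split=> // e Ce; rewrite dd'; apply: maxd.
  by apply/msa_has_chain; exists e.
split; first by apply/msa_has_chain; exists d.
by move=> e /msa_has_chain[d' /maxd le' led]; apply: leq_trans le'.
Qed.

(** Irreducibility means that one space [W_st] contains all the others. *)
Lemma msa_irreducibleP : irreducible_projective_variety (msa k Q) <->
  exists s t, component_index s t /\
    forall u v, (0 < \dim (W u v))%N -> (W u v <= W s t)%VS.
Proof.
split=> [[_ irr]|[s [t [st sub]]]].
  have [|s [t [st msaL]]] := irreducible_sub_component _ irr; first by [].
  exists s, t; split=> // u v _; apply: perp_image_subset => U LU.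
  exact/msaL/perp_image_msa/LU.
have -> : msa k Q = L s t.
  apply/seteqP; split=> [U|]; last exact: perp_image_msa.
  move=> /msa_perp_image[u [v uvU]]; apply: (perp_image_mono _ uvU); apply: sub.
  case: uvU => f [fW f0 _]; rewrite lt0n dimv_eq0.
  by apply: contraNneq f0 => W0; rewrite -memv0 -W0.
split; first exact: closed_perp_image.
exact/irreducible_perp_image/component_index_dim.
Qed.

Lemma irreducible_msa_quiver : irreducible_projective_variety (msa k Q) ->
  [\/ exists2 m, (1 <= m)%N & kronecker_quiver m Q,
      exists2 m, (1 <= m)%N & loop_quiver m Q |
      two_isolated_vertices Q].
Proof.
move=> /msa_irreducibleP[s [t [st sub]]].
have only u v : (0 < \dim (W u v))%N ->
    (u, v) = (s, t) \/ (u, v) = (t, s) /\ arrows u v = finset.set0.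
  by move=> uv; apply: perp_space_subset (sub u v uv).
have arr b : src b = s /\ tgt b = t.
  have bb : b \in arrows (src b) (tgt b) by rewrite inE !eqxx.
  have [||[_ b0]] := only (src b) (tgt b).
  - by rewrite dim_perp_space addn_gt0 card_gt0 orbC; apply/orP; left;
    apply/finset.set0Pn; exists b.
  - by case.
  - by rewrite b0 inE in bb.
(* The space of the pair [(w, s)] is nonzero, so that pair can only be [(t, s)]. *)
have ver w : w != s -> s != t /\ w = t.
  move=> ws; have [||[]] := only w s; first by rewrite dim_perp_space ws.
    by case=> es _; rewrite es eqxx in ws.
  by case=> wt _; rewrite -wt eq_sym.
(* Equal ends give a loop quiver; distinct ends give a Kronecker quiver or, without arrows, two
   isolated vertices. *)
have [est|neq] := eqVneq s t.
  have only_s w : w = s.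
    by apply/eqP/negPn/negP => /ver[]; rewrite est eqxx.
  apply: Or32; exists #|arrow Q|.
    case: st => [[]|]; first by rewrite est eqxx.
    by rewrite inE => /finset.set0Pn[b _]; apply/card_gt0P; exists b.
  split=> //; apply/eqP/fintype1P; exists s => w; exact: only_s.
have ver2 w : w = s \/ w = t.
  by have [->|/ver[_ ->]] := eqVneq w s; [left | right].
have [a0|] := posnP #|arrow Q|; last first.
  by move=> a0; apply: Or31; exists #|arrow Q| => //; exists s, t; split.
apply: Or33; split=> //.
have := cards2 s t; rewrite neq => <-; rewrite -cardsT; congr (#|pred_of_set _|).
by apply/finset.setP => w; rewrite !inE; have [->|->] := ver2 w; rewrite eqxx ?orbT.
Qed.

Lemma quiver_irreducible_msa :
  [\/ exists2 m, (1 <= m)%N & kronecker_quiver m Q,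
      exists2 m, (1 <= m)%N & loop_quiver m Q |
      two_isolated_vertices Q] -> irreducible_projective_variety (msa k Q).
Proof.
move=> quiv; apply/msa_irreducibleP.
(* This covers both the Kronecker quivers and the two isolated vertices. *)
have two s t : s != t -> (forall w, w = s \/ w = t) ->
    (forall b : arrow Q, src b = s /\ tgt b = t) ->
    forall u v, (0 < \dim (W u v))%N -> (W u v <= W s t)%VS.
  move=> st ver arr u v; rewrite dim_perp_space.
  have arr0 u' v' : (u', v') != (s, t) -> arrows u' v' = finset.set0.
    move=> ne; apply/finset.setP => b; rewrite !inE; apply/negbTE; apply: contra ne.
    by have [-> ->] := arr b; rewrite xpair_eqE ![_ == s]eq_sym ![_ == t]eq_sym.
  have [[->|->] [->|->]] := (ver u, ver v); rewrite ?subvv//.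
  - by rewrite arr0 ?cards0 ?eqxx// xpair_eqE (negPf st) andbF.
  - by move=> _; apply/perp_space_opp/arr0; rewrite xpair_eqE eq_sym (negPf st).
  - by rewrite arr0 ?cards0 ?eqxx// xpair_eqE eq_sym (negPf st).
case: quiv => [[m m0 [s [t [st ver arr cm]]]]|[m m0 [cv cm]]|[cv ca]].
- exists s, t; split; last exact: two.
  right; rewrite inE/=; move: m0; rewrite -cm => /card_gt0P[b _].
  by apply/finset.set0Pn; exists b; have [sb tb] := arr b; rewrite inE sb tb !eqxx.
- have /eqP/fintype1P[s only_s] := cv; exists s, s; split.
    right; rewrite inE/=; move: m0; rewrite -cm => /card_gt0P[b _].
    by apply/finset.set0Pn; exists b; rewrite inE !only_s !eqxx.
  by move=> u v _; rewrite (only_s u) (only_s v) subvv.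
have noarr (b : arrow Q) : False.
  by have := card0_eq ca b; rewrite inE.
have /eqP := cv; rewrite -cardsT => /finset.cards2P[s [t [st eT]]]; exists s, t;
  split.
  left; split=> //; apply/finset.setP => b; case: (noarr b).
apply: (two s t st) => [w|b]; last by case: (noarr b).
by move: (finset.in_setT w); rewrite eT !inE => /orP[]/eqP ->; [left | right].
Qed.

End Components.

Theorem corollary4p4 (k : closedFieldType) (Q : quiver) :
  (forall s t : vertex Q, s != t -> arrows s t :|: arrows t s = finset.set0 ->
    let Z : set (grassmannian (T2 k Q)) := [set A_sum k s t] in
    irreducible_component (msa k Q) Z /\ dimension Z 0) /\
  (forall s t : vertex Q, (s, t) \in V2 Q -> s != t ->
    let Z := hyp_orbits k s t `|` [set A_sum k s t] in
    irreducible_component (msa k Q) Z /\ dimension Z #|arrows s t|) /\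
  (forall s : vertex Q, (s, s) \in V2 Q ->
    let Z := hyp_orbits k s s in
    irreducible_component (msa k Q) Z /\ dimension Z (#|arrows s s| - 1)) /\
  (forall Z, irreducible_component (msa k Q) Z ->
    [\/ exists s t : vertex Q, [/\ s != t,
          arrows s t :|: arrows t s = finset.set0 & Z = [set A_sum k s t]],
        exists s t : vertex Q, [/\ (s, t) \in V2 Q, s != t &
          Z = hyp_orbits k s t `|` [set A_sum k s t]] |
        exists s : vertex Q, (s, s) \in V2 Q /\ Z = hyp_orbits k s s]) /\
  (forall Z, irreducible_component (msa k Q) Z ->
    is_projective_space (\dim {:T2 k Q} - 1) Z) /\
  (forall d, dimension (msa k Q) d <-> is_max (component_dimensions Q) d) /\
  (irreducible_projective_variety (msa k Q) <->
    [\/ exists2 m, (1 <= m)%N & kronecker_quiver m Q,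
        exists2 m, (1 <= m)%N & loop_quiver m Q |
        two_isolated_vertices Q]).
Proof.
have set0U (s t : vertex Q) : arrows s t :|: arrows t s = finset.set0 ->
    arrows s t = finset.set0.
  by move=> /eqP; rewrite finset.setU_eq0 => /andP[/eqP].
split=> [s t st st0 Z|].
  have eZ : Z = perp_image (perp_space k s t).
    by rewrite perp_image_isolated// set0U.
  rewrite eZ; split; first by apply: component_perp_image; left.
  by apply: dimension_perp_image; rewrite dim_perp_space st (set0U s t st0) cards0.
split=> [s t st neq Z|].
  rewrite /Z -perp_image_noloop//; split; first by apply: component_perp_image;
    right.
  by apply: dimension_perp_image; rewrite dim_perp_space neq add1n.
split=> [s ss Z|].
  rewrite /Z -perp_image_loop; split; first by apply: component_perp_image; right.
  apply: dimension_perp_image; rewrite dim_perp_space eqxx.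
  by move: ss; rewrite inE/= -card_gt0; case: #|_| => // n _; rewrite subn1.
split=> [Z /component_ex[s [t [[[st st0]|st] ->]]]|].
- by apply: Or31; exists s, t; rewrite perp_image_isolated// set0U.
- case: (eqVneq s t) st => [<-|neq] st.
    by apply: Or33; exists s; rewrite perp_image_loop.
  by apply: Or32; exists s, t; rewrite perp_image_noloop.
split=> [Z /component_ex[s [t [st ->]]]|].
  exact/projective_perp_image/component_index_dim.
split; first exact: msa_dimension.
split; [exact: irreducible_msa_quiver | exact: quiver_irreducible_msa].
Qed.
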